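(* Let $\mathcal{C}_n\subseteq\mathcal{R}_n$ be a zigzag set of rectangulations, and let $\mathcal{P}$ be a set of tame rectangulation patterns. Then the set $\mathcal{C}_n(\mathcal{P})$ of all rectangulations from $\mathcal{C}_n$ that avoid every pattern from $\mathcal{P}$ is a zigzag set of rectangulations. Moreover, if $\mathcal{P}$ is symmetric, then $\mathcal{C}_n(\mathcal{P})$ is symmetric.
   Context: **Rectangulations.** A (generic) rectangulation is a partition of an axis-aligned rectangle into finitely many interior-disjoint axis-aligned rectangles such that no four rectangles of the partition have a point in common. Rectangle $r$ is left of $s$ (and $s$ right of $r$) if the right side of $r$ and the left side of $s$ intersect in a line segment (not just a point); $r$ is below $s$ (and $s$ above $r$) if the top side of $r$ and the bottom side of $s$ intersect in a line segment. Rectangulations are considered up to equivalence preserving the left/right and below/above relations. $\mathcal{R}_n$, $n\ge 1$, is the set of rectangulations with $n$ rectangles, and $\square$ is the unique element of $\mathcal{R}_1$. A vertex is a corner of a rectangle of the partition, an edge is a minimal line segment between two vertices, a wall is a maximal line segment between two vertices that are not corners of the rectangulation. Every vertex that is not a corner of the rectangulation is a T-joint of type $\vdash$ (stem to the right), $\dashv$ (stem to the left), $\top$ (stem down) or $\bot$ (stem up). **Deletion.** For $R\in\mathcal{R}_n$, $n\ge2$, let $r$ be its bottom-right rectangle. If the top-left vertex of $r$ has type $\vdash$, slide the top side of $r$ (a wall) downwards until it merges with the bottom side of $r$; if it has type $\top$, slide the left side of $r$ (a wall) to the right until it merges with the right side of $r$. The result is $p(R)\in\mathcal{R}_{n-1}$.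 **Insertion.** For a rectangulation $R$, choose one interior point on every edge forming the left side of a rectangle touching the bottom boundary of $R$ (vertical insertion points), and one interior point on every edge forming the top side of a rectangle touching the right boundary of $R$ (horizontal insertion points). Order the vertical insertion points lexicographically by $(x,y)$-coordinates, followed by the horizontal ones ordered lexicographically by $(y,x)$-coordinates; this gives $I(R)=(q_1,\dots,q_\nu)$ with $\nu=\nu(R)$. For $R\in\mathcal{R}_{n-1}$ define $c_i(R)\in\mathcal{R}_n$ as follows. If $q_i$ is vertical, insert a new rectangle $r_n$ in the bottom-right corner that has above it exactly the rectangles of $R$ that lie to the right of $q_i$ and touch the bottom boundary, and to its left exactly the rectangles of $R$ that touch the vertical segment through $q_i$ (from the left) below $q_i$. If $q_i$ is horizontal, insert $r_n$ in the bottom-right corner such that it has to its left exactly the rectangles of $R$ that lie below $q_i$ and touch the right boundary, and above it exactly the rectangles of $R$ that touch the horizontal segment through $q_i$ (from above) to the right of $q_i$. In particular $c_1(R)$ (resp. $c_{\nu(R)}(R)$) is obtained by adding a rectangle below (resp. to the right of) all of $R$. **Zigzag and symmetric sets.** $\mathcal{C}_n\subseteq\mathcal{R}_n$ is zigzag if either $n=1$ and $\mathcal{C}_1=\{\square\}$, or $n\ge2$, $\mathcal{C}_{n-1}:=\{p(R)\mid R\in\mathcal{C}_n\}$ is zigzag, and for every $R\in\mathcal{C}_{n-1}$ we have $c_1(R)\in\mathcal{C}_n$ and $c_{\nu(R)}(R)\in\mathcal{C}_n$. A set of rectangulations is symmetric if reflection at the main diagonal (from top-left to bottom-right) is an involution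 of the set, i.e., with every rectangulation it also contains its reflection. **Patterns.** A rectangulation pattern is a configuration of walls with prescribed directions and incidences. A rectangulation $R$ contains the pattern $P$ if $R$ contains a subset of walls with the directions and incidences specified by $P$; otherwise $R$ avoids $P$. The pattern $P$ is tame if for every rectangulation $R$ that avoids $P$, also $c_1(R)$ and $c_{\nu(R)}(R)$ avoid $P$. A set $\mathcal{P}$ of patterns is symmetric if for each $P\in\mathcal{P}$ the pattern obtained from $P$ by reflection at the main diagonal is also in $\mathcal{P}$.
   Formalization: The second part additionally assumes that C_n itself is symmetric (without this it fails, e.g. C_3 = R_3 minus one rectangulation with P empty), and patterns are required to contain at least one wall (the empty pattern would make the first part false). *)

(* Defs.v *)
From mathcomp Require Import all_boot all_order all_fingroup all_algebra.

Set Implicit Arguments.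
Unset Strict Implicit.
Unset Printing Implicit Defensive.

Import Order.TTheory GRing.Theory Num.Theory.

Local Open Scope ring_scope.

Section Geometry.

Variable K : realFieldType.

Record rect := Rect { xl : K; xr : K; yb : K; yt : K }.

Definition nondegenerate (r : rect) : bool := (xl r < xr r) && (yb r < yt r).

Definition in_rect (r : rect) (x y : K) : bool :=
  (xl r <= x <= xr r) && (yb r <= y <= yt r).

Definition in_interior (r : rect) (x y : K) : bool :=
  (xl r < x < xr r) && (yb r < y < yt r).

Definition on_boundary (r : rect) (x y : K) : bool :=
  in_rect r x y && ~~ in_interior r x y.

Definition is_corner (r : rect) (x y : K) : bool :=
  ((x == xl r) || (x == xr r)) && ((y == yb r) || (y == yt r)).

(* The y-axis points upwards.  A rectangulation is given by coordinates and a
   numbering of its rectangles; both are forgotten by [equivalent] below.    *)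
Record rectangulation (n : nat) := Rectangulation {
  box : rect;
  cell : 'I_n -> rect;
  box_nondegenerate : nondegenerate box;
  cell_nondegenerate : forall i, nondegenerate (cell i);
  cell_cover : forall x y, in_rect box x y = [exists i, in_rect (cell i) x y];
  cell_disjoint : forall i j x y,
    i != j -> ~~ (in_interior (cell i) x y && in_interior (cell j) x y);
  no_four_meet : forall x y, (#|[set i | in_rect (cell i) x y]| <= 3)%N
}.

Section OneRectangulation.

Variables (n : nat) (R : rectangulation n).

Definition left_of (i j : 'I_n) : bool :=
  (xr (cell R i) == xl (cell R j)) &&
  (Num.max (yb (cell R i)) (yb (cell R j)) <
   Num.min (yt (cell R i)) (yt (cell R j))).

Definition below (i j : 'I_n) : bool :=
  (yt (cell R i) == yb (cell R j)) &&
  (Num.max (xl (cell R i)) (xl (cell R j)) <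
   Num.min (xr (cell R i)) (xr (cell R j))).

Definition touches_bottom (i : 'I_n) : bool := yb (cell R i) == yb (box R).
Definition touches_right (i : 'I_n) : bool := xr (cell R i) == xr (box R).

End OneRectangulation.

(* Elements of R_n are the classes of this relation. *)
Definition equivalent n (R S : rectangulation n) : Prop :=
  exists f : {perm 'I_n},
    forall i j, left_of S (f i) (f j) = left_of R i j /\
                below S (f i) (f j) = below R i j.

(* A subset of R_n, as a predicate on representatives. *)
Definition saturated n (C : rectangulation n -> Prop) : Prop :=
  forall R S, equivalent R S -> C R -> C S.

End Geometry.

Variant orientation := Horizontal | Vertical.

Section Segments.

Variable K : realFieldType.

(* [lo, hi] x {at} if horizontal, {at} x [lo, hi] if vertical. *)
Record segment :=
  Segment { seg_dir : orientation; seg_at : K; seg_lo : K; seg_hi : K }.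

Definition on_segment (s : segment) (x y : K) : bool :=
  match seg_dir s with
  | Horizontal => (y == seg_at s) && (seg_lo s <= x <= seg_hi s)
  | Vertical => (x == seg_at s) && (seg_lo s <= y <= seg_hi s)
  end.

Definition inside_segment (s : segment) (x y : K) : bool :=
  match seg_dir s with
  | Horizontal => (y == seg_at s) && (seg_lo s < x < seg_hi s)
  | Vertical => (x == seg_at s) && (seg_lo s < y < seg_hi s)
  end.

Definition subsegment (s t : segment) : Prop :=
  forall x y, on_segment s x y -> on_segment t x y.

Definition endpoint (s : segment) (x y : K) : bool :=
  match seg_dir s with
  | Horizontal => (y == seg_at s) && ((x == seg_lo s) || (x == seg_hi s))
  | Vertical => (x == seg_at s) && ((y == seg_lo s) || (y == seg_hi s))
  end.

Section OneRectangulation.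

Variables (n : nat) (R : rectangulation K n).

Definition vertex (x y : K) : bool := [exists i, is_corner (cell R i) x y].

Definition line_segment (s : segment) : Prop :=
  [/\ seg_lo s < seg_hi s,
      forall x y, endpoint s x y -> vertex x y
    & forall x y, on_segment s x y -> [exists i, on_boundary (cell R i) x y]].

Definition edge (s : segment) : Prop :=
  line_segment s /\
  forall t, line_segment t -> subsegment t s -> t = s.

(* Maximality ranges over all line segments: the sides of the box are maximal
   and end in corners, so that no segment on the boundary is a wall.         *)
Definition wall (s : segment) : Prop :=
  [/\ line_segment s,
      forall t, line_segment t -> subsegment s t -> t = s
    & forall x y, endpoint s x y -> ~~ is_corner (box R) x y].

End OneRectangulation.

End Segments.

(* T-joints by the direction of the stem: |-, -|, T, and upside-down T. *)
Variant joint := StemRight | StemLeft | StemDown | StemUp.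

Section Rectangulations.

Variable K : realFieldType.

Section VertexTypes.

Variables (n : nat) (R : rectangulation K n).

(* A line of R leaves the point (x, y) in direction d. *)
Definition arm (d : joint) (x y : K) : Prop :=
  exists2 s : segment K, line_segment R s &
    match d with
    | StemRight => [/\ seg_dir s = Horizontal, seg_at s = y & seg_lo s = x]
    | StemLeft => [/\ seg_dir s = Horizontal, seg_at s = y & seg_hi s = x]
    | StemDown => [/\ seg_dir s = Vertical, seg_at s = x & seg_hi s = y]
    | StemUp => [/\ seg_dir s = Vertical, seg_at s = x & seg_lo s = y]
    end.

Definition opposite (d : joint) : joint :=
  match d with
  | StemRight => StemLeft
  | StemLeft => StemRight
  | StemDown => StemUp
  | StemUp => StemDown
  end.

Definition vertex_type (t : joint) (x y : K) : Prop :=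
  vertex R x y /\ forall d, arm d x y <-> d <> opposite t.

End VertexTypes.

(* S is obtained from R by removing the bottom-right rectangle r; [lift r]
   enumerates the other rectangles.  Sliding the top side of r downwards moves
   precisely the bottom sides of the rectangles above r.                     *)
Definition deletes n (R : rectangulation K n.+1) (S : rectangulation K n) :
    Prop :=
  exists r : 'I_n.+1,
  [/\ touches_bottom R r, touches_right R r, box S = box R
    & let q := cell R r in
      (vertex_type R StemRight (xl q) (yt q) /\
       forall j : 'I_n, let s := cell R (lift r j) in
         cell S j = if below R r (lift r j)
                    then Rect (xl s) (xr s) (yb q) (yt s) else s)
      \/
      (vertex_type R StemDown (xl q) (yt q) /\
       forall j : 'I_n, let s := cell R (lift r j) in
         cell S j = if left_of R (lift r j) r
                    then Rect (xl s) (xr q) (yb s) (yt s) else s)].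

(* S is in the class p(R). *)
Definition parent n (R : rectangulation K n.+1) (S : rectangulation K n) :
    Prop :=
  exists2 S0, deletes R S0 & equivalent S0 S.

Definition parents n (C : rectangulation K n.+1 -> Prop) :
    rectangulation K n -> Prop :=
  fun S => exists2 R, C R & parent R S.

Section InsertionPoints.

Variables (n : nat) (R : rectangulation K n).

(* Edges on the left side of a rectangle touching the bottom boundary. *)
Definition vertical_insertion_edge (e : segment K) : Prop :=
  edge R e /\
  exists2 i, touches_bottom R i &
    [/\ seg_dir e = Vertical, seg_at e = xl (cell R i),
        yb (cell R i) <= seg_lo e & seg_hi e <= yt (cell R i)].

(* Edges on the top side of a rectangle touching the right boundary. *)
Definition horizontal_insertion_edge (e : segment K) : Prop :=
  edge R e /\
  exists2 i, touches_right R i &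
    [/\ seg_dir e = Horizontal, seg_at e = yt (cell R i),
        xl (cell R i) <= seg_lo e & seg_hi e <= xr (cell R i)].

Definition one_point_on_each (E : segment K -> Prop) (qs : seq (K * K)) :
    Prop :=
  (forall q, q \in qs -> exists2 e, E e & inside_segment e q.1 q.2) /\
  (forall e, E e -> count (fun q => inside_segment e q.1 q.2) qs = 1%N).

Definition lex_xy (p q : K * K) : bool :=
  (p.1 < q.1) || ((p.1 == q.1) && (p.2 < q.2)).
Definition lex_yx (p q : K * K) : bool :=
  (p.2 < q.2) || ((p.2 == q.2) && (p.1 < q.1)).

(* I(R) = vs ++ hs for some choice of the interior points. *)
Definition insertion_points (vs hs : seq (K * K)) : Prop :=
  [/\ one_point_on_each vertical_insertion_edge vs, sorted lex_xy vs,
      one_point_on_each horizontal_insertion_edge hs & sorted lex_yx hs].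

Definition is_nu (k : nat) : Prop :=
  exists vs hs, insertion_points vs hs /\ k = size (vs ++ hs).

(* S is obtained from R by cutting out of the bottom-right corner the
   rectangle r_n = cell S ord_max whose top-left vertex is q.  For a vertical
   insertion point, only the rectangles to the right of q touching the bottom
   boundary are cut; for a horizontal one, only those below q touching the
   right boundary.  As S is a rectangulation, the cut rectangles are exactly
   those above (resp. to the left of) r_n, and the ones to the left of
   (resp. above) r_n are those touching the segment from q down to the bottom
   boundary from the left (resp. from q to the right boundary from above).   *)
Definition inserts (vert : bool) (q : K * K) (S : rectangulation K n.+1) :
    Prop :=
  [/\ box S = box R,
      cell S ord_max = Rect q.1 (xr (box R)) (yb (box R)) q.2
    & forall j : 'I_n, let s := cell R j in
        cell S (lift ord_max j) =
          if vert then
            if touches_bottom R j && (q.1 <= xl s)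
            then Rect (xl s) (xr s) q.2 (yt s) else s
          else
            if touches_right R j && (yt s <= q.2)
            then Rect (xl s) q.1 (yb s) (yt s) else s].

End InsertionPoints.

(* S is in the class c_i(R), 1 <= i <= nu(R).  A given drawing of R need not
   have room for r_n, whence the passage to an equivalent R0.                *)
Definition child n (R : rectangulation K n) (i : nat)
    (S : rectangulation K n.+1) : Prop :=
  exists (R0 : rectangulation K n) (vs hs : seq (K * K))
         (S0 : rectangulation K n.+1),
  [/\ equivalent R R0, insertion_points R0 vs hs,
      (0 < i <= size (vs ++ hs))%N,
      inserts R0 (i <= size vs)%N (nth (0, 0) (vs ++ hs) i.-1) S0
    & equivalent S0 S].

Definition first_child n (R : rectangulation K n) S : Prop := child R 1 S.

Definition last_child n (R : rectangulation K n) S : Prop :=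
  exists2 k, is_nu R k & child R k S.

Lemma square_nondegenerate : nondegenerate (@Rect K 0 1 0 1).
Proof. by rewrite /nondegenerate /= ltr01. Qed.

Definition square : rectangulation K 1.
Proof.
refine (@Rectangulation K 1 (Rect 0 1 0 1) (fun=> Rect 0 1 0 1)
  square_nondegenerate (fun=> square_nondegenerate) _ _ _).
- by move=> x y; apply/idP/existsP => [h|[]//]; exists ord0.
- by move=> i j x y; rewrite (ord1 i) (ord1 j) eqxx.
- by move=> x y; apply: leq_trans (max_card _) _; rewrite card_ord.
Defined.

Inductive zigzag : forall n, (rectangulation K n -> Prop) -> Prop :=
| zigzag_square (C : rectangulation K 1 -> Prop) :
    (forall R, C R <-> equivalent square R) -> zigzag C
| zigzag_parents n (C : rectangulation K n.+2 -> Prop) :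
    saturated C ->
    zigzag (parents C) ->
    (forall R, parents C R -> forall S, first_child R S -> C S) ->
    (forall R, parents C R -> forall S, last_child R S -> C S) ->
    zigzag C.

(* Reflection at the main diagonal: (x, y) |-> (- y, - x). *)
Definition reflect_rect (r : rect K) : rect K :=
  Rect (- yt r) (- yb r) (- xr r) (- xl r).

Lemma in_reflect_rect r x y :
  in_rect (reflect_rect r) x y = in_rect r (- y) (- x).
Proof.
rewrite /in_rect /= (lerNl (yt r)) (lerNr x) (lerNl (xr r)) (lerNr y).
by rewrite andbC [X in X && _]andbC [X in _ && X]andbC.
Qed.

Lemma in_interior_reflect_rect r x y :
  in_interior (reflect_rect r) x y = in_interior r (- y) (- x).
Proof.
rewrite /in_interior /= (ltrNl (yt r)) (ltrNr x) (ltrNl (xr r)) (ltrNr y).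
by rewrite andbC [X in X && _]andbC [X in _ && X]andbC.
Qed.

Lemma nondegenerate_reflect_rect r :
  nondegenerate r -> nondegenerate (reflect_rect r).
Proof. by rewrite /nondegenerate /= !ltrN2 andbC. Qed.

Definition reflect n (R : rectangulation K n) : rectangulation K n.
Proof.
refine (@Rectangulation K n (reflect_rect (box R))
  (fun i => reflect_rect (cell R i))
  (nondegenerate_reflect_rect (box_nondegenerate R))
  (fun i => nondegenerate_reflect_rect (cell_nondegenerate R i)) _ _ _).
- move=> x y; rewrite in_reflect_rect (cell_cover R).
  by apply: eq_existsb => i; rewrite in_reflect_rect.
- by move=> i j x y ij; rewrite !in_interior_reflect_rect (cell_disjoint R).
- move=> x y; apply: leq_trans (no_four_meet R (- y) (- x)).
  by rewrite subset_leq_card //; apply/subsetP => i; rewrite !inE in_reflect_rect.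
Defined.

Definition symmetric_rectangulations n (C : rectangulation K n -> Prop) :
    Prop :=
  forall R, C R -> C (reflect R).

End Rectangulations.

(* Walls are numbered.  [pat_joint a b t] prescribes that wall a ends at wall b
   in a T-joint of type t.  [pat_before w a b] prescribes that walls a and b
   both end at w, the joint of a preceding that of b; joints on w are read from
   left to right if w is horizontal, from top to bottom if w is vertical.  A
   pattern may leave the order of the joints on a wall open.                 *)
Record pattern := Pattern {
  pat_walls : nat;
  pat_walls_gt0 : (0 < pat_walls)%N;
  pat_dir : 'I_pat_walls -> orientation;
  pat_joint : 'I_pat_walls -> 'I_pat_walls -> joint -> bool;
  pat_before : 'I_pat_walls -> 'I_pat_walls -> 'I_pat_walls -> bool
}.

Definition pattern_iso (P Q : pattern) : Prop :=
  exists f : 'I_(pat_walls P) -> 'I_(pat_walls Q),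
  [/\ bijective f,
      forall a, pat_dir (f a) = pat_dir a,
      forall a b t, pat_joint (f a) (f b) t = pat_joint a b t
    & forall w a b, pat_before (f w) (f a) (f b) = pat_before w a b].

Definition reflect_orientation (d : orientation) : orientation :=
  match d with Horizontal => Vertical | Vertical => Horizontal end.

Definition reflect_joint (t : joint) : joint :=
  match t with
  | StemRight => StemDown
  | StemDown => StemRight
  | StemLeft => StemUp
  | StemUp => StemLeft
  end.

(* The reflection maps the left-to-right order of the joints on a horizontal
   wall to their top-to-bottom order on a vertical wall.                     *)
Definition reflect_pattern (P : pattern) : pattern :=
  @Pattern (pat_walls P) (pat_walls_gt0 P)
    (fun a => reflect_orientation (pat_dir a))
    (fun a b t => pat_joint a b (reflect_joint t))
    (fun w a b => pat_before w a b).

Definition symmetric_patterns (PP : pattern -> Prop) : Prop :=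
  forall P, PP P -> exists2 Q, PP Q & pattern_iso Q (reflect_pattern P).

Section Containment.

Variable K : realFieldType.

(* The wall s ends at the wall w in a T-joint of type t. *)
Definition t_joint (s w : segment K) (t : joint) : Prop :=
  seg_lo w < seg_at s < seg_hi w /\
  match t with
  | StemRight =>
      [/\ seg_dir s = Horizontal, seg_dir w = Vertical & seg_lo s = seg_at w]
  | StemLeft =>
      [/\ seg_dir s = Horizontal, seg_dir w = Vertical & seg_hi s = seg_at w]
  | StemDown =>
      [/\ seg_dir s = Vertical, seg_dir w = Horizontal & seg_hi s = seg_at w]
  | StemUp =>
      [/\ seg_dir s = Vertical, seg_dir w = Horizontal & seg_lo s = seg_at w]
  end.

Definition joint_before (w s s' : segment K) : Prop :=
  [/\ exists t, t_joint s w t,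
      exists t, t_joint s' w t
    & match seg_dir w with
      | Horizontal => seg_at s < seg_at s'
      | Vertical => seg_at s' < seg_at s
      end].

Definition contains n (R : rectangulation K n) (P : pattern) : Prop :=
  exists f : 'I_(pat_walls P) -> segment K,
  [/\ injective f,
      forall a, wall R (f a) /\ seg_dir (f a) = pat_dir a,
      forall a b t, pat_joint a b t -> t_joint (f a) (f b) t
    & forall w a b, pat_before w a b -> joint_before (f w) (f a) (f b)].

Definition avoids n (R : rectangulation K n) (P : pattern) : Prop :=
  ~ contains R P.

Definition tame (P : pattern) : Prop :=
  forall n (R : rectangulation K n), avoids R P ->
    (forall S, first_child R S -> avoids S P) /\
    (forall S, last_child R S -> avoids S P).

Definition avoiding n (C : rectangulation K n -> Prop) (PP : pattern -> Prop) :
    rectangulation K n -> Prop :=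
  fun R => C R /\ forall P, PP P -> avoids R P.

End Containment.

(* Main.v *)
Require Import Defs.
From mathcomp Require Import all_boot all_order all_fingroup all_algebra.
From mathcomp Require Import lra.
From Stdlib Require Import Classical.

(** Avoidance of a pattern only depends on the equivalence class, because a wall
    together with its joints can be read off from the relations left/right and
    below/above: the contacts between cells along a wall are connected to each
    other, since no four cells meet in a point. Deleting the bottom-right cell
    slides away one wall and only lengthens those that ended at it, so every
    pattern of p(R) already occurs in R and p preserves avoidance. Conversely
    c_1 is a section of p that preserves avoidance of tame patterns, so that p
    maps the pattern-avoiding part of C_n onto the pattern-avoiding part of
    p(C_n), and induction on the zigzag structure concludes. *)

Set Implicit Arguments.
Unset Strict Implicit.
Unset Printing Implicit Defensive.

Import Order.TTheory GRing.Theory Num.Theory Defs.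

Local Open Scope ring_scope.

(** * Cells *)

(** A wall is defined by maximality among segments that end in vertices, which gives no hold on its
    position. The working notion is therefore [vwall]: a segment on a vertical line that no cell
    crosses and that is blocked at both ends. In this form most case distinctions reduce to linear
    arithmetic. Arguments are made for vertical walls; reflection at the main diagonal exchanges the
    two directions, keeps the bottom-right corner in place and exchanges the two kinds of deletion.
    Equivalent drawings need not have any coordinates in common, and a relabelling speaks of cells
    only. Walls are matched through the cells that touch them, and a joint is recognised by the two
    cells in the angles next to its stem. For c_1 the drawing of R can be kept: the new cell is a
    strip along the bottom, lower than every horizontal side that is not on the bottom of the box,
    so that deleting it returns R itself and not merely an equivalent drawing. *)

Section Cells.

Variable K : realFieldType.

(** A step to the right of [x] so short that it passes no member of [s]. With the coordinates of the
    cells as [s], it stands for a point infinitesimally close to [x]. *)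
Lemma rightward_gap (s : seq K) (x b : K) : x < b ->
  exists x', [/\ x < x', x' <= b & forall z, z \in s -> z <= x' -> z <= x].
Proof.
move=> xb; elim: s => [|z s [x' [xx' x'b IH]]]; first by exists b.
case: (lerP z x) => zx.
  exists x'; split=> // u; rewrite inE => /orP[/eqP->//|]; exact: IH.
case: (ltrP x' z) => x'z.
  exists x'; split=> // u; rewrite inE => /orP[/eqP-> ?|]; [lra|exact: IH].
exists ((x + z) / 2); split=> [||u]; try lra.
rewrite inE => /orP[/eqP-> ?|us ?]; [lra|apply: IH => //; lra].
Qed.

Lemma leftward_gap (s : seq K) (x b : K) : b < x ->
  exists x', [/\ x' < x, b <= x' & forall z, z \in s -> x' <= z -> x <= z].
Proof.
move=> bx; have [|x' [h1 h2 h]] := @rightward_gap [seq - z | z <- s] (- x) (- b).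
  lra.
exists (- x'); split=> [||z zs zx]; try lra.
by have := h (- z) (map_f _ zs); lra.
Qed.

Lemma common_point (a b c d : K) : a < c -> a < d -> b < c -> b < d ->
  exists m, a < m < c /\ b < m < d.
Proof.
move=> *; exists ((Num.max a b + Num.min c d) / 2).
by case: (leP a b); case: (leP c d) => *; lra.
Qed.

Variables (n : nat) (R : rectangulation K n).
Implicit Types i j k : 'I_n.

Local Notation x0 i := (xl (cell R i)).
Local Notation x1 i := (xr (cell R i)).
Local Notation y0 i := (yb (cell R i)).
Local Notation y1 i := (yt (cell R i)).
Local Notation X0 := (xl (box R)).
Local Notation X1 := (xr (box R)).
Local Notation Y0 := (yb (box R)).
Local Notation Y1 := (yt (box R)).

Lemma cell_lt i : x0 i < x1 i /\ y0 i < y1 i.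
Proof. by have /andP[] := cell_nondegenerate R i. Qed.

Lemma box_lt : X0 < X1 /\ Y0 < Y1.
Proof. by have /andP[] := box_nondegenerate R. Qed.

Lemma cell_in_box i : [/\ X0 <= x0 i, x1 i <= X1, Y0 <= y0 i & y1 i <= Y1].
Proof.
have [h1 h2] := cell_lt i.
have : in_rect (box R) (x0 i) (y0 i).
  by rewrite cell_cover; apply/existsP; exists i; rewrite /in_rect; lra.
have : in_rect (box R) (x1 i) (y1 i).
  by rewrite cell_cover; apply/existsP; exists i; rewrite /in_rect; lra.
by rewrite /in_rect => ? ?; split; lra.
Qed.

Lemma cells_apart i j : i != j ->
  [\/ x1 i <= x0 j, x1 j <= x0 i, y1 i <= y0 j | y1 j <= y0 i].
Proof.
move=> ij; have [? ?] := cell_lt i; have [? ?] := cell_lt j.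
case: (lerP (x1 i) (x0 j)) => ?; first exact: Or41.
case: (lerP (x1 j) (x0 i)) => ?; first exact: Or42.
case: (lerP (y1 i) (y0 j)) => ?; first exact: Or43.
case: (lerP (y1 j) (y0 i)) => ?; first exact: Or44.
have [||||x [hx hx']] := @common_point (x0 i) (x0 j) (x1 i) (x1 j) => //.
have [||||y [hy hy']] := @common_point (y0 i) (y0 j) (y1 i) (y1 j) => //.
by have := cell_disjoint R x y ij; rewrite /in_interior hx hx' hy hy'.
Qed.

Lemma overlap_eq i j : x0 i < x1 j -> x0 j < x1 i -> y0 i < y1 j ->
  y0 j < y1 i -> i = j.
Proof.
move=> *; apply/eqP; case: eqVneq => // ij.
by have [] := cells_apart ij; lra.
Qed.

(** Since [k] extends to both sides of the line on which [i] has a side, the two cells overlap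
    horizontally, and only their heights can separate them. *)
Lemma crossing_apart i k c : x0 k < c < x1 k -> x0 i = c \/ x1 i = c ->
  y1 k <= y0 i \/ y1 i <= y0 k.
Proof.
move=> ck ic; have [? _] := cell_lt i; case: (eqVneq k i) => [ki|/cells_apart].
  by exfalso; rewrite ki in ck; lra.
by case=> ?; [exfalso; lra|exfalso; lra|left|right].
Qed.

(** Covering by closed cells does not tell on which side of a point a cell lies. It is applied at a
    point moved slightly to the right and upwards, and as no left or bottom side is passed on the
    way, the cell found there is half-open around (x, y). The next three lemmas treat the other
    quadrants. *)
Lemma cell_NE x y : X0 <= x < X1 -> Y0 <= y < Y1 ->
  exists i, [/\ x0 i <= x < x1 i & y0 i <= y < y1 i].
Proof.
move=> /andP[hx /(rightward_gap [seq x0 i | i : 'I_n]) [x' [h1 h2 h3]]].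
move=> /andP[hy /(rightward_gap [seq y0 i | i : 'I_n]) [y' [k1 k2 k3]]].
have : in_rect (box R) x' y' by rewrite /in_rect; lra.
rewrite cell_cover => /existsP[i]; rewrite /in_rect => hi.
have := h3 (x0 i) (image_f _ (isT : i \in 'I_n)).
have := k3 (y0 i) (image_f _ (isT : i \in 'I_n)).
by exists i; split; lra.
Qed.

Lemma cell_NW x y : X0 < x <= X1 -> Y0 <= y < Y1 ->
  exists i, [/\ x0 i < x <= x1 i & y0 i <= y < y1 i].
Proof.
move=> /andP[/(leftward_gap [seq x1 i | i : 'I_n]) [x' [h1 h2 h3]] hx].
move=> /andP[hy /(rightward_gap [seq y0 i | i : 'I_n]) [y' [k1 k2 k3]]].
have : in_rect (box R) x' y' by rewrite /in_rect; lra.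
rewrite cell_cover => /existsP[i]; rewrite /in_rect => hi.
have := h3 (x1 i) (image_f _ (isT : i \in 'I_n)).
have := k3 (y0 i) (image_f _ (isT : i \in 'I_n)).
by exists i; split; lra.
Qed.

Lemma cell_SE x y : X0 <= x < X1 -> Y0 < y <= Y1 ->
  exists i, [/\ x0 i <= x < x1 i & y0 i < y <= y1 i].
Proof.
move=> /andP[hx /(rightward_gap [seq x0 i | i : 'I_n]) [x' [h1 h2 h3]]].
move=> /andP[/(leftward_gap [seq y1 i | i : 'I_n]) [y' [k1 k2 k3]] hy].
have : in_rect (box R) x' y' by rewrite /in_rect; lra.
rewrite cell_cover => /existsP[i]; rewrite /in_rect => hi.
have := h3 (x0 i) (image_f _ (isT : i \in 'I_n)).
have := k3 (y1 i) (image_f _ (isT : i \in 'I_n)).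
by exists i; split; lra.
Qed.

Lemma cell_SW x y : X0 < x <= X1 -> Y0 < y <= Y1 ->
  exists i, [/\ x0 i < x <= x1 i & y0 i < y <= y1 i].
Proof.
move=> /andP[/(leftward_gap [seq x1 i | i : 'I_n]) [x' [h1 h2 h3]] hx].
move=> /andP[/(leftward_gap [seq y1 i | i : 'I_n]) [y' [k1 k2 k3]] hy].
have : in_rect (box R) x' y' by rewrite /in_rect; lra.
rewrite cell_cover => /existsP[i]; rewrite /in_rect => hi.
have := h3 (x1 i) (image_f _ (isT : i \in 'I_n)).
have := k3 (y1 i) (image_f _ (isT : i \in 'I_n)).
by exists i; split; lra.
Qed.

Lemma not_four_meet x y (s : seq 'I_n) : uniq s -> size s = 4%N ->
  (forall i, i \in s -> in_rect (cell R i) x y) -> False.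
Proof.
move=> us ss h; have := no_four_meet R x y.
rewrite leqNgt -ss -(card_uniqP us) => /negP; apply.
by apply: subset_leq_card; apply/subsetP => i /h; rewrite inE.
Qed.

(** The existential over cells becomes a condition on each cell: a covered point is on the boundary
    of some cell exactly when no cell has it in its interior, because a cell does not meet the
    interior of another one. *)
Lemma line_segmentP s : line_segment R s <->
  [/\ seg_lo s < seg_hi s, forall x y, endpoint s x y -> vertex R x y,
      forall x y, on_segment s x y -> in_rect (box R) x y
    & forall i x y, on_segment s x y -> ~~ in_interior (cell R i) x y].
Proof.
split=> [[h1 h2 h3]|[h1 h2 h3 h4]]; split=> //.
- move=> x y /h3/existsP[i /andP[hi _]].
  by rewrite cell_cover; apply/existsP; exists i.
- move=> i x y /h3/existsP[j]; rewrite /on_boundary => /andP[hj hj'].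
  apply/negP => hi; case: (eqVneq i j) => [ij|/cells_apart].
    by rewrite -ij hi in hj'.
  have [? ?] := cell_lt j.
  by move: hi hj; rewrite /in_interior /in_rect => ? ? []; lra.
- move=> x y sxy; have := h3 x y sxy; rewrite cell_cover => /existsP[i hi].
  by apply/existsP; exists i; rewrite /on_boundary hi h4.
Qed.

End Cells.

(** * Reflection and walls *)

Section Reflection.

Variable K : realFieldType.
Implicit Types (s w t : segment K) (x y : K).

Definition reflect_segment s : segment K :=
  Segment (reflect_orientation (seg_dir s)) (- seg_at s)
    (- seg_hi s) (- seg_lo s).

Lemma reflect_segmentK : involutive reflect_segment.
Proof. by case=> [[] a l h]; rewrite /reflect_segment /= !opprK. Qed.

Lemma reflect_jointK : involutive reflect_joint.
Proof. by case. Qed.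

Lemma on_reflect_segment s x y :
  on_segment (reflect_segment s) x y = on_segment s (- y) (- x).
Proof.
by case: s => [[] a l h]; rewrite /on_segment /= !eq_le; apply/idP/idP => ?; lra.
Qed.

Lemma endpoint_reflect_segment s x y :
  endpoint (reflect_segment s) x y = endpoint s (- y) (- x).
Proof.
by case: s => [[] a l h]; rewrite /endpoint /= !eq_le; apply/idP/idP => ?; lra.
Qed.

Lemma is_corner_reflect_rect (r : rect K) x y :
  is_corner (reflect_rect r) x y = is_corner r (- y) (- x).
Proof. by rewrite /is_corner /=; rewrite !eq_le; apply/idP/idP => ?; lra. Qed.

Lemma reflect_subsegment s t :
  subsegment s t -> subsegment (reflect_segment s) (reflect_segment t).
Proof. by move=> st x y; rewrite !on_reflect_segment; apply: st. Qed.

Variables (n : nat) (R : rectangulation K n).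

Lemma vertex_reflect x y : vertex (reflect R) x y = vertex R (- y) (- x).
Proof. by apply: eq_existsb => i; rewrite is_corner_reflect_rect. Qed.

Lemma boundary_reflect x y :
  [exists i, on_boundary (cell (reflect R) i) x y] =
  [exists i, on_boundary (cell R i) (- y) (- x)].
Proof.
apply: eq_existsb => i.
by rewrite /on_boundary in_reflect_rect in_interior_reflect_rect.
Qed.

Lemma line_segment_reflect s :
  line_segment (reflect R) (reflect_segment s) <-> line_segment R s.
Proof.
split=> -[h1 h2 h3]; split.
- by move: h1 => /=; lra.
- move=> x y sxy; have := h2 (- y) (- x).
  by rewrite endpoint_reflect_segment vertex_reflect !opprK; apply.
- move=> x y sxy; have := h3 (- y) (- x).
  by rewrite on_reflect_segment boundary_reflect !opprK; apply.
- by move=> /=; lra.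
- by move=> x y; rewrite endpoint_reflect_segment vertex_reflect; apply: h2.
- by move=> x y; rewrite on_reflect_segment boundary_reflect; apply: h3.
Qed.

Lemma wall_reflect s : wall (reflect R) (reflect_segment s) <-> wall R s.
Proof.
split=> -[/line_segment_reflect h1 h2 h3]; split=> //.
- move=> t ht st; have := h2 (reflect_segment t).
  move=> /(_ (proj2 (line_segment_reflect t) ht) (reflect_subsegment st)).
  exact: (inv_inj reflect_segmentK).
- move=> x y sxy; have := h3 (- y) (- x).
  by rewrite endpoint_reflect_segment is_corner_reflect_rect !opprK; apply.
- move=> t; rewrite -[t]reflect_segmentK => /line_segment_reflect ht st.
  congr reflect_segment; apply: h2 => // x y sxy.
  have := st (- y) (- x); rewrite !on_reflect_segment !opprK; exact.
- move=> x y; rewrite endpoint_reflect_segment is_corner_reflect_rect.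
  exact: h3.
Qed.

Lemma t_joint_reflect s w (t : joint) :
  t_joint s w t -> t_joint (reflect_segment s) (reflect_segment w) (reflect_joint t).
Proof.
case: s w => [ds sa sl sh] [dw wa wl wh]; rewrite /t_joint /= => -[h1 h2].
by split; [lra|case: t h2 => -[-> -> ->]].
Qed.

Lemma joint_before_reflect w s s' : joint_before w s s' ->
  joint_before (reflect_segment w) (reflect_segment s) (reflect_segment s').
Proof.
case=> -[t ht] [t' ht'] h; split.
- by exists (reflect_joint t); apply: t_joint_reflect.
- by exists (reflect_joint t'); apply: t_joint_reflect.
- by case: w h {ht ht'} => -[] wa wl wh /=; lra.
Qed.

(** Stated with a hypothesis on walls rather than with [reflect], so that it serves both directions:
    a double reflection of R is not convertible to R. *)
Lemma contains_reflected_walls (R' : rectangulation K n) P :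
  (forall s, wall R' s -> wall R (reflect_segment s)) ->
  contains R' P -> contains R (reflect_pattern P).
Proof.
move=> hw [f [injf hf hj hb]]; exists (fun a => reflect_segment (f a)).
split=> [a b /(inv_inj reflect_segmentK)/injf//|a|a b t|w a b].
- by have [/hw wa da] := hf a; split; last by rewrite /= da.
- by move=> /hj/t_joint_reflect; rewrite reflect_jointK.
- by move=> /hb/joint_before_reflect.
Qed.

Lemma contains_reflect P : contains (reflect R) P -> contains R (reflect_pattern P).
Proof.
apply: contains_reflected_walls => s ws.
by apply/wall_reflect; rewrite reflect_segmentK.
Qed.

Lemma contains_pattern_iso P Q : pattern_iso Q P -> contains R P -> contains R Q.
Proof.
move=> [g [bg hd hj hb]] [f [injf hf hj' hb']]; exists (f \o g).
split=> [|a|a b t|w a b] /=.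
- exact: inj_comp injf (bij_inj bg).
- by rewrite -hd; apply: hf.
- by rewrite -hj; apply: hj'.
- by rewrite -hb; apply: hb'.
Qed.

End Reflection.

Lemma reflect_contains (K : realFieldType) n (R : rectangulation K n) P :
  contains R P -> contains (reflect R) (reflect_pattern P).
Proof. by apply: contains_reflected_walls => s /wall_reflect. Qed.

(** A pattern reflected twice is recovered only up to [pattern_iso], its components agreeing
    pointwise. *)
Lemma contains_reflectK (K : realFieldType) n (R : rectangulation K n) P :
  contains (reflect R) (reflect_pattern P) -> contains R P.
Proof.
move=> /contains_reflect; apply: contains_pattern_iso.
exists id; split=> [|a|a b t|w a b] //=; first by exists id.
  by case: pat_dir.
by rewrite reflect_jointK.
Qed.

(** * Walls described by the cells that block them *)

Section Walls.

Variables (K : realFieldType) (n : nat) (R : rectangulation K n).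
Implicit Types i j k : 'I_n.

Local Notation x0 i := (xl (cell R i)).
Local Notation x1 i := (xr (cell R i)).
Local Notation y0 i := (yb (cell R i)).
Local Notation y1 i := (yt (cell R i)).
Local Notation X0 := (xl (box R)).
Local Notation X1 := (xr (box R)).
Local Notation Y0 := (yb (box R)).
Local Notation Y1 := (yt (box R)).

(* Each end lies on the box or inside a horizontal side of a cell that blocks
   the extension of the wall. *)
Record vwall (c lo hi : K) : Prop := VWall {
  vwall_in : [/\ X0 < c < X1, lo < hi, Y0 <= lo & hi <= Y1];
  vwall_clear : forall i, x0 i < c < x1 i -> y1 i <= lo \/ hi <= y0 i;
  vwall_lo : lo = Y0 \/ exists2 i, x0 i < c < x1 i & y1 i = lo;
  vwall_hi : hi = Y1 \/ exists2 i, x0 i < c < x1 i & y0 i = hi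
}.

Record hwall (c lo hi : K) : Prop := HWall {
  hwall_in : [/\ Y0 < c < Y1, lo < hi, X0 <= lo & hi <= X1];
  hwall_clear : forall i, y0 i < c < y1 i -> x1 i <= lo \/ hi <= x0 i;
  hwall_lo : lo = X0 \/ exists2 i, y0 i < c < y1 i & x1 i = lo;
  hwall_hi : hi = X1 \/ exists2 i, y0 i < c < y1 i & x0 i = hi
}.

Definition is_wall (s : segment K) : Prop :=
  match seg_dir s with
  | Vertical => vwall (seg_at s) (seg_lo s) (seg_hi s)
  | Horizontal => hwall (seg_at s) (seg_lo s) (seg_hi s)
  end.

(** A maximal segment on a vertical side of the box must be this whole side, and its ends are
    corners of the box. This excludes walls on the boundary. *)
Lemma side_of_box c : c = X0 \/ c = X1 ->
  line_segment R (Segment Vertical c Y0 Y1).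
Proof.
move=> hc; have [hx hy] := box_lt R; apply/line_segmentP; split=> //=.
- move=> x y; rewrite /endpoint /= => hxy; apply/existsP.
  case: hc => hc; case: (ltP y Y1) => hy1.
  + have [||i [? ?]] := @cell_NE _ _ R x Y0; try lra.
    have [? ? ? ?] := cell_in_box R i; exists i; rewrite /is_corner !eq_le; lra.
  + have [||i [? ?]] := @cell_SE _ _ R x Y1; try lra.
    have [? ? ? ?] := cell_in_box R i; exists i; rewrite /is_corner !eq_le; lra.
  + have [||i [? ?]] := @cell_NW _ _ R x Y0; try lra.
    have [? ? ? ?] := cell_in_box R i; exists i; rewrite /is_corner !eq_le; lra.
  + have [||i [? ?]] := @cell_SW _ _ R x Y1; try lra.
    have [? ? ? ?] := cell_in_box R i; exists i; rewrite /is_corner !eq_le; lra.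
- by move=> x y; rewrite /on_segment /in_rect /=; case: hc => ->; lra.
- move=> i x y; rewrite /on_segment /in_interior /=.
  by have [] := cell_in_box R i; case: hc => ->; lra.
Qed.

Lemma vertical_clear c lo hi : lo < hi ->
  (forall i x y, on_segment (Segment Vertical c lo hi) x y ->
    ~~ in_interior (cell R i) x y) ->
  forall i, x0 i < c < x1 i -> y1 i <= lo \/ hi <= y0 i.
Proof.
move=> lohi h i ci; have [_ ?] := cell_lt R i.
case: (lerP (y1 i) lo) => ?; first by left.
case: (lerP hi (y0 i)) => ?; first by right.
have [||||m [m1 m2]] := @common_point _ lo (y0 i) hi (y1 i) => //.
have m1' : lo <= m <= hi by lra.
by have := h i c m; rewrite /on_segment /in_interior /= eqxx m1' ci m2 => /(_ isT).
Qed.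

(** Consider the cells directly below the lower end, one on each side of the line. If one of them
    crosses the line, it blocks the segment; otherwise both have a side on the line, and the segment
    continues to the nearer of their bottom sides, where there is a vertex. *)
Lemma extend_down c lo hi :
  line_segment R (Segment Vertical c lo hi) -> X0 < c < X1 -> Y0 < lo ->
  (exists2 i, x0 i < c < x1 i & y1 i = lo) \/
  (exists2 lo', lo' < lo & line_segment R (Segment Vertical c lo' hi)).
Proof.
move=> /line_segmentP[/= lohi ends inbox int_s] cin ?.
have clear := vertical_clear lohi int_s.
have {inbox} [hb1 hb2] : Y0 <= lo /\ hi <= Y1.
  have := inbox c lo; have := inbox c hi; rewrite /on_segment /in_rect /= => ? ?.
  by split; lra.
have [||i [hi1 hi2]] := @cell_SE _ _ R c lo; try lra.
have [||j [hj1 hj2]] := @cell_SW _ _ R c lo; try lra.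
case: (ltrP (x0 i) c) => ic; first by left; exists i; have := clear i; lra.
have {}ic : x0 i = c by lra.
case: (ltrP c (x1 j)) => ?; first by left; exists j; have := clear j; lra.
pose lo' := Num.max (y0 i) (y0 j).
have [lo1 lo2 lo3] : [/\ y0 i <= lo', y0 j <= lo' & lo' = y0 i \/ lo' = y0 j].
  by rewrite /lo'; case: (leP (y0 i) (y0 j)) => h; split=> //; auto; apply: ltW.
right; exists lo'; first lra.
apply/line_segmentP; split=> /=; first lra.
+ move=> x y exy; case: (eqVneq y hi) => [yhi|yhi].
    by apply: ends; move: exy; rewrite /endpoint /=; lra.
  move: exy; rewrite /endpoint /= => exy.
  apply/existsP; case: lo3 => ?; [exists i|exists j];
    rewrite /is_corner !eq_le; lra.
+ move=> x y; have [? ? ? ?] := cell_in_box R i.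
  by rewrite /on_segment /in_rect /=; lra.
+ move=> k x y; case: (lerP lo y) => ? sxy.
    by apply: int_s; move: sxy; rewrite /on_segment /=; lra.
  move: sxy; rewrite /on_segment /in_interior /= => sxy; apply/negP => kxy.
  have ck : x0 k < c < x1 k by lra.
  by case: (crossing_apart ck (or_introl ic)) => ?; lra.
Qed.

Lemma extend_up c lo hi :
  line_segment R (Segment Vertical c lo hi) -> X0 < c < X1 -> hi < Y1 ->
  (exists2 i, x0 i < c < x1 i & y0 i = hi) \/
  (exists2 hi', hi < hi' & line_segment R (Segment Vertical c lo hi')).
Proof.
move=> /line_segmentP[/= lohi ends inbox int_s] cin ?.
have clear := vertical_clear lohi int_s.
have {inbox} [hb1 hb2] : Y0 <= lo /\ hi <= Y1.
  have := inbox c lo; have := inbox c hi; rewrite /on_segment /in_rect /= => ? ?.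
  by split; lra.
have [||i [hi1 hi2]] := @cell_NE _ _ R c hi; try lra.
have [||j [hj1 hj2]] := @cell_NW _ _ R c hi; try lra.
case: (ltrP (x0 i) c) => ic; first by left; exists i; have := clear i; lra.
have {}ic : x0 i = c by lra.
case: (ltrP c (x1 j)) => ?; first by left; exists j; have := clear j; lra.
pose hi' := Num.min (y1 i) (y1 j).
have [hi3 hi4 hi5] : [/\ hi' <= y1 i, hi' <= y1 j & hi' = y1 i \/ hi' = y1 j].
  by rewrite /hi'; case: (leP (y1 i) (y1 j)) => h; split=> //; auto; apply: ltW.
right; exists hi'; first lra.
apply/line_segmentP; split=> /=; first lra.
+ move=> x y exy; case: (eqVneq y lo) => [yhi|yhi].
    by apply: ends; move: exy; rewrite /endpoint /=; lra.
  move: exy; rewrite /endpoint /= => exy.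
  apply/existsP; case: hi5 => ?; [exists i|exists j];
    rewrite /is_corner !eq_le; lra.
+ move=> x y; have [? ? ? ?] := cell_in_box R i.
  by rewrite /on_segment /in_rect /=; lra.
+ move=> k x y; case: (lerP y hi) => ? sxy.
    by apply: int_s; move: sxy; rewrite /on_segment /=; lra.
  move: sxy; rewrite /on_segment /in_interior /= => sxy; apply/negP => kxy.
  have ck : x0 k < c < x1 k by lra.
  by case: (crossing_apart ck (or_introl ic)) => ?; lra.
Qed.

Lemma vwall_of_wall c lo hi : wall R (Segment Vertical c lo hi) -> vwall c lo hi.
Proof.
case=> ls max_s corner_s; have := ls => /line_segmentP[/= lohi ends inbox int_s].
have [bx by_] := box_lt R.
have h1 := inbox c lo; have h2 := inbox c hi; rewrite /on_segment /in_rect /= in h1 h2.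
have {h1 h2 inbox} [cbox [hb1 hb2]] : X0 <= c <= X1 /\ Y0 <= lo /\ hi <= Y1.
  by split; [|split]; lra.
have not_side : c = X0 \/ c = X1 -> False.
  move=> hc; have [] : Segment Vertical c Y0 Y1 = Segment Vertical c lo hi.
    by apply: max_s (side_of_box hc) _ => x y; rewrite /on_segment /=; lra.
  move=> e1 e2; have := corner_s c lo; rewrite /endpoint /is_corner /= => h.
  by case: hc => hc; lra.
have {not_side cbox} cin : X0 < c < X1.
  have ? : c != X0 by apply/eqP => ?; apply: not_side; left.
  have ? : c != X1 by apply/eqP => ?; apply: not_side; right.
  lra.
split=> //; first exact: vertical_clear int_s.
- case: (ltrP Y0 lo) => hlo; [right|by left; lra].
  case: (extend_down ls cin hlo) => // -[lo' lo'lo ls'].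
  have [] : Segment Vertical c lo' hi = Segment Vertical c lo hi; last lra.
  by apply: max_s ls' _ => x y; rewrite /on_segment /=; lra.
- case: (ltrP hi Y1) => hhi; [right|by left; lra].
  case: (extend_up ls cin hhi) => // -[hi' hi'hi ls'].
  have [] : Segment Vertical c lo hi' = Segment Vertical c lo hi; last lra.
  by apply: max_s ls' _ => x y; rewrite /on_segment /=; lra.
Qed.

Lemma wall_of_vwall c lo hi : vwall c lo hi -> wall R (Segment Vertical c lo hi).
Proof.
case=> -[cin lohi loin hiin] clear wlo whi; split.
- apply/line_segmentP; split=> //=.
  + move=> x y; rewrite /endpoint /= => /andP[/eqP-> /orP[/eqP->|/eqP->]].
    (* The cell above and to the right of the lower end has its corner there: its left side is on
       the line because no cell crosses the wall, and it cannot reach below [lo] because of the box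
       or the blocking cell. *)
    * have [||i [hi1 hi2]] := @cell_NE _ _ R c lo; try lra.
      apply/existsP; exists i; have ci := clear i; rewrite /is_corner !eq_le.
      have [? ? ? ?] := cell_in_box R i.
      have : y0 i = lo.
        case: wlo => [|[k kc ky]]; first lra.
        case: (ltrP (y0 i) lo) => ?; last lra.
        have [? ?] := cell_lt R k; have ic : x0 i = c by lra.
        by case: (crossing_apart kc (or_introl ic)) => ?; lra.
      lra.
    * have [||i [hi1 hi2]] := @cell_SE _ _ R c hi; try lra.
      apply/existsP; exists i; have ci := clear i; rewrite /is_corner !eq_le.
      have [? ? ? ?] := cell_in_box R i.
      have : y1 i = hi.
        case: whi => [|[k kc ky]]; first lra.
        case: (ltrP hi (y1 i)) => ?; last lra.
        have [? ?] := cell_lt R k; have ic : x0 i = c by lra.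
        by case: (crossing_apart kc (or_introl ic)) => ?; lra.
      lra.
  + by move=> x y; rewrite /on_segment /in_rect /=; lra.
  + move=> i x y; rewrite /on_segment /in_interior /=.
    by have := clear i; lra.
- case=> [d a l h] /line_segmentP[/= lh _ inbox int_t] st.
  case: d inbox int_t st => inbox int_t st.
    exfalso; have := st c lo; have := st c hi; rewrite /on_segment /=; lra.
  have h1 := st c lo; have h2 := st c hi; rewrite /on_segment /= in h1 h2.
  have ac : a = c by lra.
  rewrite ac in int_t inbox; have clear_t := vertical_clear lh int_t.
  have b1 := inbox c l; have b2 := inbox c h; rewrite /on_segment /in_rect /= in b1 b2.
  (* A segment reaching further down would leave the box or enter the interior of the blocking
     cell. *)
  have ll : l = lo.
    case: wlo => [|[k kc ky]]; first lra.
    by have := clear_t k; have [? ?] := cell_lt R k; lra.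
  have hh : h = hi.
    case: whi => [|[k kc ky]]; first lra.
    by have := clear_t k; have [? ?] := cell_lt R k; lra.
  by rewrite ac ll hh.
- by move=> x y; rewrite /endpoint /is_corner /=; lra.
Qed.

End Walls.

Section WallsReflection.

Variables (K : realFieldType) (n : nat) (R : rectangulation K n).

Lemma vwall_reflect c lo hi :
  vwall (reflect R) (- c) (- hi) (- lo) <-> hwall R c lo hi.
Proof.
split=> -[[/= h1 h2 h3 h4] clear wlo whi]; split=> /=; try (split; lra).
- by move=> i; have /= := clear i; lra.
- by case: whi => [|[i /= ? ?]]; [left; lra|right; exists i; lra].
- by case: wlo => [|[i /= ? ?]]; [left; lra|right; exists i; lra].
- by move=> i; have /= := clear i; lra.
- by case: whi => [->|[i /= ? <-]]; [left|right; exists i; lra].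
- by case: wlo => [->|[i /= ? <-]]; [left|right; exists i; lra].
Qed.

Lemma hwall_reflect c lo hi :
  hwall (reflect R) (- c) (- hi) (- lo) <-> vwall R c lo hi.
Proof.
split=> -[[/= h1 h2 h3 h4] clear wlo whi]; split=> /=; try (split; lra).
- by move=> i; have /= := clear i; lra.
- by case: whi => [|[i /= ? ?]]; [left; lra|right; exists i; lra].
- by case: wlo => [|[i /= ? ?]]; [left; lra|right; exists i; lra].
- by move=> i; have /= := clear i; lra.
- by case: whi => [->|[i /= ? <-]]; [left|right; exists i; lra].
- by case: wlo => [->|[i /= ? <-]]; [left|right; exists i; lra].
Qed.

Lemma is_wall_reflect s : is_wall (reflect R) (reflect_segment s) <-> is_wall R s.
Proof. by case: s => [[] a l h]; [apply: vwall_reflect|apply: hwall_reflect]. Qed.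

End WallsReflection.

Lemma wallP (K : realFieldType) n (R : rectangulation K n) s :
  wall R s <-> is_wall R s.
Proof.
case: s => [[] a l h].
- rewrite -wall_reflect -is_wall_reflect.
  by split; [apply: vwall_of_wall|apply: wall_of_vwall].
- by split; [apply: vwall_of_wall|apply: wall_of_vwall].
Qed.

(** * Cells along a wall *)

Lemma least_above (K : realFieldType) (s : seq K) (y b : K) : y <= b ->
  exists m, [/\ y <= m <= b, m = b \/ m \in s
              & forall z, z \in s -> y <= z -> m <= z].
Proof.
move=> yb; elim: s => [|z s [m [ymb mb IH]]].
  by exists b; split=> //; [lra|left].
case: (boolP (y <= z < m)) => zm.
  exists z; split; [lra|by right; rewrite mem_head|].
  by move=> u; rewrite inE => /orP[/eqP->//|/IH]; lra.
exists m; split=> //; first by case: mb; [left|rewrite inE => ->; right; rewrite orbT].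
by move=> u; rewrite inE => /orP[/eqP->|/IH//]; lra.
Qed.

Lemma greatest_below (K : realFieldType) (s : seq K) (y b : K) : b <= y ->
  exists m, [/\ b <= m <= y, m = b \/ m \in s
              & forall z, z \in s -> z <= y -> z <= m].
Proof.
move=> yb; have [|m [h1 h2 h3]] := @least_above K [seq - z | z <- s] (- y) (- b).
  lra.
exists (- m); split=> [||z zs zy]; first lra.
  case: h2 => [->|]; first by left; rewrite opprK.
  by move=> /mapP[z zs ->]; right; rewrite opprK.
by have := h3 (- z) (map_f _ zs); lra.
Qed.

Section Sides.

Variables (K : realFieldType) (n : nat) (R : rectangulation K n).
Implicit Types (i j k : 'I_n) (b : bool) (c lo hi : K).

Local Notation x0 i := (xl (cell R i)).
Local Notation x1 i := (xr (cell R i)).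
Local Notation y0 i := (yb (cell R i)).
Local Notation y1 i := (yt (cell R i)).
Local Notation X0 := (xl (box R)).
Local Notation X1 := (xr (box R)).
Local Notation Y0 := (yb (box R)).
Local Notation Y1 := (yt (box R)).

(* The vertical side of the cell [i] that faces a wall to its left ([b] true)
   or to its right ([b] false). *)
Definition side b i : K := if b then x0 i else x1 i.

Definition on_vwall c lo hi b i : Prop := [/\ side b i = c, lo <= y0 i & y1 i <= hi].

(** Contact across the vertical side [b] of [i]; the boolean lets one argument cover both sides of a
    wall. *)
Definition adjacent b i j : bool := if b then left_of R j i else left_of R i j.

Lemma left_ofP i j :
  Bool.reflect [/\ x1 i = x0 j, y0 i < y1 j & y0 j < y1 i] (left_of R i j).
Proof.
have [? ?] := cell_lt R i; have [? ?] := cell_lt R j.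
apply: (iffP andP) => [[/eqP-> ]|[-> ? ?]].
  by rewrite gt_max !lt_min => ?; split=> //; lra.
by rewrite eqxx gt_max !lt_min; split=> //; lra.
Qed.

Lemma belowP i j :
  Bool.reflect [/\ y1 i = y0 j, x0 i < x1 j & x0 j < x1 i] (below R i j).
Proof.
have [? ?] := cell_lt R i; have [? ?] := cell_lt R j.
apply: (iffP andP) => [[/eqP-> ]|[-> ? ?]].
  by rewrite gt_max !lt_min => ?; split=> //; lra.
by rewrite eqxx gt_max !lt_min; split=> //; lra.
Qed.

Lemma adjacentP b i j :
  Bool.reflect [/\ side b i = side (~~ b) j, y0 i < y1 j & y0 j < y1 i] (adjacent b i j).
Proof. by case: b; apply: (iffP (left_ofP _ _)) => -[]. Qed.

Lemma adjacentC b i j : adjacent b i j = adjacent (~~ b) j i.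
Proof. by case: b. Qed.

Lemma side_eq b i j : side b i = side b j -> y0 i < y1 j -> y0 j < y1 i -> i = j.
Proof.
have [? _] := cell_lt R i; have [? _] := cell_lt R j.
by case: b => /= ? ? ?; apply: (@overlap_eq _ _ R) => //; lra.
Qed.

Lemma side_neq b i j : side b i = side (~~ b) j -> i <> j.
Proof. by have [? _] := cell_lt R j; case: b => /= + ij; rewrite ij; lra. Qed.

Lemma side_crossing_apart b i k c : x0 k < c < x1 k -> side b i = c ->
  y1 k <= y0 i \/ y1 i <= y0 k.
Proof.
by move=> ck ic; apply: (crossing_apart ck); move: ic; case: b; [left|right].
Qed.

Lemma in_rect_side b i c y : side b i = c -> y0 i <= y <= y1 i -> in_rect (cell R i) c y.
Proof. by have [? _] := cell_lt R i; rewrite /in_rect /side; case: b => ? ?; lra. Qed.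

(** All four cells contain the point (c, y), and those on opposite sides of the line are distinct.
    Where one side shows two cells, the other can therefore show only one. *)
Lemma no_cross b c y i j k l :
  side b i = c -> side b j = c -> side (~~ b) k = c -> side (~~ b) l = c ->
  y0 i <= y <= y1 i -> y0 j <= y <= y1 j -> y0 k <= y <= y1 k ->
  y0 l <= y <= y1 l -> i != j -> k = l.
Proof.
move=> ic jc kc lc hi hj hk hl ij; apply/eqP; apply: contraT => kl.
have ne p q : side b p = c -> side (~~ b) q = c -> p != q.
  by move=> pc qc; apply/eqP; apply: (@side_neq b); rewrite pc qc.
exfalso; apply: (@not_four_meet _ _ R c y [:: i; j; k; l]) => //.
  by rewrite /= !inE !negb_or ij kl !ne.
move=> p; rewrite !inE => /or4P[] /eqP->.
- exact: in_rect_side ic hi.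
- exact: in_rect_side jc hj.
- exact: in_rect_side kc hk.
- exact: in_rect_side lc hl.
Qed.

Section OneWall.

Variables (c lo hi : K).
Hypothesis W : vwall R c lo hi.
Local Notation on := (on_vwall c lo hi).

(** A cell on the line that passed an end of the wall would be at the same height as the blocking
    cell there, contrary to [side_crossing_apart]. *)
Lemma side_within b i : side b i = c -> y0 i < hi -> lo < y1 i -> on b i.
Proof.
move=> ic ihi loi; have [? ?] := cell_lt R i; have [? ? ? ?] := cell_in_box R i.
case: W => _ _ wlo whi; split=> //.
  case: wlo => [->//|[k ck ky]]; rewrite leNgt; apply/negP => h.
  have [? ?] := cell_lt R k.
  by case: (side_crossing_apart ck ic) => ?; lra.
case: whi => [->//|[k ck ky]]; rewrite leNgt; apply/negP => h.
have [? ?] := cell_lt R k.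
by case: (side_crossing_apart ck ic) => ?; lra.
Qed.

Lemma cell_above b y : lo <= y < hi ->
  exists i, [/\ on b i, y0 i <= y & y < y1 i].
Proof.
case: W => -[cin lohi loin hiin] clear _ _ hy.
suff [i [ic h1 h2]] : exists i, [/\ side b i = c, y0 i <= y & y < y1 i].
  by exists i; split=> //; apply: side_within => //; lra.
case: b.
  have [||i [hi1 hi2]] := @cell_NE _ _ R c y; try lra.
  by exists i; have := clear i; rewrite /side; split; lra.
have [||i [hi1 hi2]] := @cell_NW _ _ R c y; try lra.
by exists i; have := clear i; rewrite /side; split; lra.
Qed.

Lemma cell_below b y : lo < y <= hi ->
  exists i, [/\ on b i, y0 i < y & y <= y1 i].
Proof.
case: W => -[cin lohi loin hiin] clear _ _ hy.
suff [i [ic h1 h2]] : exists i, [/\ side b i = c, y0 i < y & y <= y1 i].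
  by exists i; split=> //; apply: side_within => //; lra.
case: b.
  have [||i [hi1 hi2]] := @cell_SE _ _ R c y; try lra.
  by exists i; have := clear i; rewrite /side; split; lra.
have [||i [hi1 hi2]] := @cell_SW _ _ R c y; try lra.
by exists i; have := clear i; rewrite /side; split; lra.
Qed.

Lemma adjacent_on b i j : adjacent b i j -> on b i -> on (~~ b) j.
Proof.
move=> /adjacentP[ij h1 h2] [ic loi ihi].
by apply: side_within; [rewrite -ij|lra|lra].
Qed.

(* The joints on the two sides of a wall are at different heights, as otherwise
   four cells would meet; so the cells along the wall form a zigzag. *)
Lemma vwall_connected (P : bool -> 'I_n -> Prop) :
  (forall b i j, adjacent b i j -> P b i -> P (~~ b) j) ->
  forall b i b' j, on b i -> on b' j -> P b i -> P b' j.
Proof.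
move=> adjP; have [[_ lohi _ _] _ _ _] := W.
have adjPE b i j : adjacent b i j -> (P b i <-> P (~~ b) j).
  move=> h; split; first exact: adjP.
  by rewrite -{2}[b]negbK; apply: adjP; rewrite -adjacentC.
(* The lowest cell to the right of the wall serves as reference; the induction is on the number of
   cells that start below [i]. *)
have [|r [[rc lor rhi] hr1 hr2]] := @cell_above true lo; first lra.
suff main b i : on b i -> (P b i <-> P true r).
  by move=> b i b' j /main-> /main->.
have [m] := ubnP #|[set k | y0 k < y0 i]|.
elim: m b i => // m IH b i; rewrite ltnS => im oni; have [ic loi ihi] := oni.
have [_ ?] := cell_lt R i; have [_ ?] := cell_lt R r.
case: (eqVneq (y0 i) lo) => ilo.
  case: b ic {oni} => ic; first by rewrite (@side_eq true i r) ?rc //; lra.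
  by apply: (adjPE false); apply/adjacentP; rewrite ic rc; split=> //; lra.
have loi' : lo < y0 i <= hi by lra.
have loi'' : lo <= y0 i < hi by lra.
(* Here [a] is the next cell below [i] on the same side, and [e] and [d] are the cells across the
   wall just below and just above the joint between them. By [no_cross], [d] and [e] coincide, and
   this cell links [i] to [a]. *)
have [a [ona ha1 ha2]] := cell_below b loi'.
have [e [one he1 he2]] := cell_below (~~ b) loi'.
have [d [ond hd1 hd2]] := cell_above (~~ b) loi''.
have [ac _ _] := ona; have [ec _ _] := one; have [dc _ _] := ond.
have ai : y1 a = y0 i.
  case: (ltrP (y0 i) (y1 a)) => ?; last lra.
  by have ea : a = i; [apply: (@side_eq b); [rewrite ac ic|lra|lra]|rewrite ea in ha1; lra].
have <- : P b a <-> P true r.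
  apply: IH => //; apply: leq_trans im; apply: proper_card; apply/properP.
  split; last by exists a; rewrite !inE // ltxx.
  by apply/subsetP => k; rewrite !inE => /lt_trans; apply.
have adj_ae : adjacent b a e by apply/adjacentP; rewrite ac ec; split=> //; lra.
have adj_id : adjacent b i d by apply/adjacentP; rewrite ic dc; split=> //; lra.
rewrite (adjPE _ _ _ adj_id) (adjPE _ _ _ adj_ae).
suff -> : d = e by [].
by apply: (no_cross (y := y0 i) ic ac dc ec); try lra; apply/eqP => eia;
  rewrite -eia in ha1; lra.
Qed.

(** Both walls run along the side of [i]. If one ended before the other, its blocking cell would
    cross the longer one. *)
Lemma vwall_unique c' lo' hi' b i : vwall R c' lo' hi' ->
  on b i -> on_vwall c' lo' hi' b i -> [/\ c' = c, lo' = lo & hi' = hi].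
Proof.
case: W => -[cin lohi loin hiin] clear wlo whi.
case=> -[cin' lohi' loin' hiin'] clear' wlo' whi'.
move=> [ic loi ihi] [ic' loi' ihi']; have e : c' = c by rewrite -ic'.
have [_ ?] := cell_lt R i; rewrite {}e {ic ic'} in clear' wlo' whi' *; split=> //.
  apply/eqP; rewrite eq_le; apply/andP; split; rewrite leNgt; apply/negP => h.
    case: wlo' => [|[k /clear ck]]; first lra.
    by have [_ ?] := cell_lt R k; lra.
  case: wlo => [|[k /clear' ck]]; first lra.
  by have [_ ?] := cell_lt R k; lra.
apply/eqP; rewrite eq_le; apply/andP; split; rewrite leNgt; apply/negP => h.
  case: whi => [|[k /clear' ck]]; first lra.
  by have [_ ?] := cell_lt R k; lra.
case: whi' => [|[k /clear ck]]; first lra.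
by have [_ ?] := cell_lt R k; lra.
Qed.

End OneWall.

(** The wall is grown from a height [y] inside the contact of the two cells, up and down to the
    nearest cell that crosses the line, or to the box. *)
Lemma vwall_exists i j : left_of R i j -> exists c lo hi,
  [/\ vwall R c lo hi, on_vwall c lo hi false i & on_vwall c lo hi true j].
Proof.
move=> /left_ofP[ij h1 h2].
have [xi yi] := cell_lt R i; have [xj yj] := cell_lt R j.
have [? ? ? ?] := cell_in_box R i; have [? ? ? ?] := cell_in_box R j.
have [||||y [hy1 hy2]] := @common_point K (y0 i) (y0 j) (y1 i) (y1 j) => //.
have [c cj] : exists c, c = x0 j by exists (x0 j).
rewrite -cj in ij.
pose X := [seq k <- enum 'I_n | x0 k < c < x1 k].
have inX k : x0 k < c < x1 k -> k \in X by rewrite mem_filter mem_enum andbT.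
have Xin k : k \in X -> x0 k < c < x1 k by rewrite mem_filter => /andP[].
have cin : X0 < c < X1 by lra.
have kapart k : x0 k < c < x1 k -> y1 k <= y0 i \/ y1 i <= y0 k.
  by move=> ck; apply: (crossing_apart ck); right; rewrite ij.
have off k : x0 k < c < x1 k -> y1 k <= y \/ y <= y0 k.
  by move=> /kapart[]?; [left|right]; lra.
have [|hi [hhi whi hhi']] := @least_above K [seq y0 k | k <- X] y Y1; first lra.
have [|lo [hlo wlo hlo']] := @greatest_below K [seq y1 k | k <- X] y Y0; first lra.
have clear k : x0 k < c < x1 k -> y1 k <= lo \/ hi <= y0 k.
  move=> ck; have kX := inX _ ck; case: (off k ck) => hk.
    by left; apply: hlo' => //; apply: map_f.
  by right; apply: hhi' => //; apply: map_f.
have {}wlo : lo = Y0 \/ exists2 k, x0 k < c < x1 k & y1 k = lo.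
  by case: wlo => [|/mapP[k /Xin kX ->]]; [left|right; exists k].
have {}whi : hi = Y1 \/ exists2 k, x0 k < c < x1 k & y0 k = hi.
  by case: whi => [|/mapP[k /Xin kX ->]]; [left|right; exists k].
have ylo : lo < y.
  case: wlo => [|[k /kapart ck ky]]; first lra.
  by have [_ ?] := cell_lt R k; lra.
have yhi : y < hi.
  case: whi => [|[k /kapart ck ky]]; first lra.
  by have [_ ?] := cell_lt R k; lra.
have W : vwall R c lo hi.
  split=> //; split=> //; first exact: lt_trans ylo yhi.
    by case/andP: hlo.
  by case/andP: hhi.
move/andP: hy1 => [? ?]; move/andP: hy2 => [? ?].
by exists c, lo, hi; split=> //; apply: side_within => //;
  first [exact: lt_trans yhi|exact: lt_trans ylo _].
Qed.

End Sides.

(** * Equivalent rectangulations *)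

Section Joints.

Variables (K : realFieldType) (n : nat) (R : rectangulation K n).
Implicit Types (i j k : 'I_n) (b : bool) (c lo hi : K).

Local Notation x0 i := (xl (cell R i)).
Local Notation x1 i := (xr (cell R i)).
Local Notation y0 i := (yb (cell R i)).
Local Notation y1 i := (yt (cell R i)).

Definition on_hwall c lo hi b i : Prop :=
  [/\ (if b then y0 i else y1 i) = c, lo <= x0 i & x1 i <= hi].

Definition touches (s : segment K) b i : Prop :=
  match seg_dir s with
  | Vertical => on_vwall R (seg_at s) (seg_lo s) (seg_hi s) b i
  | Horizontal => on_hwall (seg_at s) (seg_lo s) (seg_hi s) b i
  end.

(** The reflection turns above into left and below into right, hence the negation of [b]. *)
Lemma on_vwall_reflect c lo hi b i :
  on_vwall (reflect R) (- c) (- hi) (- lo) b i <-> on_hwall c lo hi (~~ b) i.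
Proof. by rewrite /on_vwall /on_hwall; case: b => /=; split=> -[*]; split; lra. Qed.

Lemma hwall_within c lo hi b i : hwall R c lo hi ->
  (if b then y0 i else y1 i) = c -> x0 i < hi -> lo < x1 i -> on_hwall c lo hi b i.
Proof.
move=> /vwall_reflect H ic h1 h2; rewrite -[b]negbK -on_vwall_reflect.
by apply: side_within => //=; move: ic; case: b => /=; lra.
Qed.

(* The horizontal segment [l, h] x {a} ends at the vertical line x = c, coming
   from its right ([b] true) or from its left ([b] false). *)
Definition ends_at c b l h : Prop := (if b then l else h) = c.

Section OneJoint.

Variables (c lo hi a l h : K).
Hypotheses (W : vwall R c lo hi) (H : hwall R a l h).

(** A joint leaves its trace in two cells on the side of the stem: both touch the wall, one lies on
    the stem and one under it. *)
Lemma joint_cells b : ends_at c b l h -> lo < a < hi -> exists i j,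
  [/\ on_vwall R c lo hi b i, on_vwall R c lo hi b j,
      on_hwall a l h true i & on_hwall a l h false j].
Proof.
move=> lc ha; have ha1 : lo <= a < hi by lra.
have ha2 : lo < a <= hi by lra.
have [i [oni hi1 hi2]] := cell_above W b ha1.
have [j [onj hj1 hj2]] := cell_below W b ha2.
have [[_ lh _ _] clear _ _] := H.
have [? _] := cell_lt R i; have [? _] := cell_lt R j.
have [ic _ _] := oni; have [jc _ _] := onj.
exists i, j; split=> //; apply: hwall_within => //.
- have := clear i; move: ic lc; rewrite /ends_at /side.
  by case: (b) => /= ? ? ?; lra.
- by move: ic lc; rewrite /ends_at /side; case: (b) => /= ? ?; lra.
- by move: ic lc; rewrite /ends_at /side; case: (b) => /= ? ?; lra.
- have := clear j; move: jc lc; rewrite /ends_at /side.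
  by case: (b) => /= ? ? ?; lra.
- by move: jc lc; rewrite /ends_at /side; case: (b) => /= ? ?; lra.
- by move: jc lc; rewrite /ends_at /side; case: (b) => /= ? ?; lra.
Qed.

(** Converse of [joint_cells]. If the horizontal wall continued beyond the line, it would also
    separate two cells on the other side at height [a], and four cells would meet. *)
Lemma cells_joint b i j :
  on_vwall R c lo hi b i -> on_vwall R c lo hi b j ->
  on_hwall a l h true i -> on_hwall a l h false j ->
  ends_at c b l h /\ lo < a < hi.
Proof.
move=> [ic loi ihi] [jc loj jhi] [ia li ih] [ja lj jh].
have [xi yi] := cell_lt R i; have [xj yj] := cell_lt R j.
have ha : lo < a < hi by lra.
split=> //; have [[_ lh _ _] clear _ _] := H.
have ha1 : lo <= a < hi by lra.
have ha2 : lo < a <= hi by lra.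
have [k [[kc _ _] hk1 hk2]] := cell_above W (~~ b) ha1.
have [m [[mc _ _] hm1 hm2]] := cell_below W (~~ b) ha2.
rewrite /ends_at; apply/eqP; apply: contraT => lc; exfalso.
have [xk _] := cell_lt R k; have [xm _] := cell_lt R m.
have ka : y0 k = a.
  have := clear k; move: ic kc lc; rewrite /side.
  by case: (b) => /= ? ? ? ?; lra.
have ma : y1 m = a.
  have := clear m; move: ic mc lc; rewrite /side.
  by case: (b) => /= ? ? ? ?; lra.
have ij : i != j by apply/eqP => e; rewrite e in ia; lra.
have km : k = m by apply: (no_cross (y := a) ic jc kc mc) => //; lra.
by rewrite km in ka; lra.
Qed.

End OneJoint.

Definition stem_side (t : joint) : bool :=
  match t with StemRight | StemUp => true | StemLeft | StemDown => false end.

Lemma t_joint_vertical (s w : segment K) t : seg_dir w = Vertical -> t_joint s w t ->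
  [/\ seg_dir s = Horizontal, ends_at (seg_at w) (stem_side t) (seg_lo s) (seg_hi s)
    & seg_lo w < seg_at s < seg_hi w].
Proof. by move=> wv [h]; rewrite wv; case: t => -[] // -> _ ->. Qed.

End Joints.

(** * Matching the walls of equivalent drawings *)

Section Relabelling.

Variable K : realFieldType.

Definition relabels n (f : 'I_n -> 'I_n) (R S : rectangulation K n) : Prop :=
  forall i j, left_of S (f i) (f j) = left_of R i j /\
              below S (f i) (f j) = below R i j.

Definition corresponds n (f : 'I_n -> 'I_n) (R S : rectangulation K n)
    (s s' : segment K) : Prop :=
  seg_dir s' = seg_dir s /\ forall b i, touches R s b i -> touches S s' b (f i).

Section Reflect.

Variables (n : nat) (R : rectangulation K n).

Lemma left_of_reflect i j : left_of (reflect R) i j = below R j i.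
Proof.
by apply/left_ofP/belowP => /= -[*]; split; lra.
Qed.

Lemma below_reflect i j : below (reflect R) i j = left_of R j i.
Proof.
by apply/belowP/left_ofP => /= -[*]; split; lra.
Qed.

Lemma touches_reflect s b i :
  touches (reflect R) (reflect_segment s) b i <-> touches R s (~~ b) i.
Proof.
case: s => [[] c lo hi]; first exact: on_vwall_reflect.
by rewrite /touches /on_vwall /on_hwall /side; case: b => /=; split=> -[*]; split; lra.
Qed.

End Reflect.

Lemma relabels_reflect n (f : 'I_n -> 'I_n) (R S : rectangulation K n) :
  relabels f R S -> relabels f (reflect R) (reflect S).
Proof.
by move=> h i j; rewrite !left_of_reflect !below_reflect; case: (h j i).
Qed.

Lemma corresponds_reflect n (f : 'I_n -> 'I_n) (R S : rectangulation K n) s s' :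
  corresponds f R S s s' ->
  corresponds f (reflect R) (reflect S) (reflect_segment s) (reflect_segment s').
Proof.
case=> ds h; split=> [|b i /touches_reflect/h ?]; first by rewrite /= ds.
exact/touches_reflect.
Qed.

Section Transport.

Variables (n : nat) (f : 'I_n -> 'I_n) (R S : rectangulation K n).
Hypothesis fRS : relabels f R S.

Lemma adjacent_relabel b i j : adjacent S b (f i) (f j) = adjacent R b i j.
Proof. by case: b => /=; [case: (fRS j i)|case: (fRS i j)]. Qed.

(** One contact at the lower end of the wall determines a wall of S. Touching that wall passes from
    cell to cell across contacts, so [vwall_connected] extends it to all cells along the original
    wall. *)
Lemma vwall_transport c lo hi : vwall R c lo hi -> exists c' lo' hi',
  vwall S c' lo' hi' /\
  forall b i, on_vwall R c lo hi b i -> on_vwall S c' lo' hi' b (f i).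
Proof.
move=> W; have [[_ lohi _ _] _ _ _] := W.
have hlo : lo <= lo < hi by lra.
have [i [oni i1 i2]] := cell_above W false hlo.
have [j [onj j1 j2]] := cell_above W true hlo.
have ij : left_of R i j.
  apply/left_ofP; case: oni => ic ? ?; case: onj => jc ? ?.
  by split; [rewrite [LHS]ic [RHS]jc|lra|lra].
have [c' [lo' [hi' [W' oni' onj']]]] : exists c lo hi,
  [/\ vwall S c lo hi, on_vwall S c lo hi false (f i) & on_vwall S c lo hi true (f j)].
  by apply: vwall_exists; rewrite (proj1 (fRS i j)).
exists c', lo', hi'; split=> // b k onk.
apply: (vwall_connected W (P := fun b i => on_vwall S c' lo' hi' b (f i))) onk oni'.
  move=> b' p q pq; apply: (adjacent_on W'); by rewrite adjacent_relabel.
exact: oni.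
Qed.

(** Consecutive cells on one side of the wall are stacked, so that their order follows from [below],
    which the relabelling preserves. *)
Lemma vwall_order_same c lo hi b k l : vwall R c lo hi ->
  on_vwall R c lo hi b k -> on_vwall R c lo hi b l ->
  yb (cell R k) < yb (cell R l) -> yb (cell S (f k)) < yb (cell S (f l)).
Proof.
move=> W onk; have [m] := ubnP #|[set p | yb (cell R p) < yb (cell R l)]|.
elim: m l => // m IH l; rewrite ltnS => lm onl kl.
have [kc lok khi] := onk; have [lc lol lhi] := onl.
have [_ ?] := cell_lt R k; have [_ ?] := cell_lt R l.
have hl : lo < yb (cell R l) <= hi by lra.
have [p [onp p1 p2]] := cell_below W b hl; have [pc _ _] := onp.
have pl : yt (cell R p) = yb (cell R l).
  case: (ltrP (yb (cell R l)) (yt (cell R p))) => ?; last lra.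
  have e : p = l by apply: (@side_eq _ _ R b); [rewrite pc lc|lra|lra].
  by rewrite e in p1; lra.
have : below R p l.
  have [? _] := cell_lt R p; have [? _] := cell_lt R l; apply/belowP.
  by move: lc pc; rewrite /side; case: (b) => ? ?; split=> //; lra.
rewrite -(proj2 (fRS p l)) => /belowP[fpl _ _].
have [_ fp] := cell_lt S (f p).
case: (ltrgtP (yb (cell R k)) (yb (cell R p))) => kp.
- suff: yb (cell S (f k)) < yb (cell S (f p)) by lra.
  apply: IH => //; apply: leq_trans lm; apply: proper_card; apply/properP.
  split; last by exists p; rewrite !inE // ltxx.
  by apply/subsetP => q; rewrite !inE => /lt_trans; apply.
- have e : k = p by apply: (@side_eq _ _ R b); [rewrite pc kc|lra|lra].
  by rewrite e in kp; lra.
- have -> : k = p by apply: (@side_eq _ _ R b); [rewrite pc kc|lra|lra].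
  lra.
Qed.

(** Compares two joints, given by the top of a cell under one stem and the bottom of a cell on the
    other. If the stems are on different sides, the cell [p] opposite the top of [j] mediates: its
    contact with [j] is preserved, and [k] is either [p] or lies below [p] on the same side. *)
Lemma vwall_order c lo hi b b' j k : vwall R c lo hi ->
  on_vwall R c lo hi b j -> on_vwall R c lo hi b' k ->
  yb (cell R k) < yt (cell R j) -> yb (cell S (f k)) < yt (cell S (f j)).
Proof.
move=> W onj onk kj; have [jc loj jhi] := onj; have [kc lok khi] := onk.
have [_ ?] := cell_lt R k; have [_ ?] := cell_lt R j.
suff [p [onp p1 p2 p3]] : exists p, [/\ on_vwall R c lo hi b' p,
    yb (cell R p) < yt (cell R j), yt (cell R j) <= yt (cell R p)
    & yb (cell S (f p)) < yt (cell S (f j))].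
  have [pc _ _] := onp.
  case: (ltrP (yb (cell R k)) (yb (cell R p))) => kp.
    by have := vwall_order_same W onk onp kp; lra.
  have <- : p = k by apply: (@side_eq _ _ R b'); [rewrite pc kc|lra|lra].
  exact: p3.
case: (eqVneq b b') => bb.
  by exists j; rewrite -bb; split=> //; case: (cell_lt S (f j)).
have {bb} bb : b' = ~~ b by case: (b) (b') bb => -[].
have hj : lo < yt (cell R j) <= hi by lra.
have [p [onp p1 p2]] := cell_below W b' hj; have [pc _ _] := onp.
exists p; split=> //.
have : adjacent R b j p by apply/adjacentP; rewrite -bb jc pc; split=> //; lra.
by rewrite -adjacent_relabel => /adjacentP[].
Qed.

End Transport.

Lemma wall_transport n (f : 'I_n -> 'I_n) (R S : rectangulation K n) s :
  relabels f R S -> is_wall R s -> exists2 s', is_wall S s' & corresponds f R S s s'.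
Proof.
case: s => [[] c lo hi] fRS W.
  have /vwall_reflect W' : hwall R c lo hi by [].
  have [c' [lo' [hi' [W'' h]]]] := vwall_transport (relabels_reflect fRS) W'.
  exists (Segment Horizontal (- c') (- hi') (- lo')).
    by apply/vwall_reflect; rewrite !opprK.
  split=> // b i.
  rewrite /touches /= -[b]negbK -!on_vwall_reflect !opprK; exact: h.
have [c' [lo' [hi' [W'' h]]]] := vwall_transport fRS W.
by exists (Segment Vertical c' lo' hi').
Qed.

Lemma wall_touched n (R : rectangulation K n) s : is_wall R s -> exists i, touches R s true i.
Proof.
case: s => [[] c lo hi] W.
  have /vwall_reflect W' : hwall R c lo hi by [].
  have [|i [oni _ _]] := @cell_above _ _ _ _ _ _ W' false (- hi).
    by have [[_ ? _ _] _ _ _] := W'; lra.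
  by exists i; apply/(on_vwall_reflect _ _ _ _ false).
have [|i [oni _ _]] := @cell_above _ _ _ _ _ _ W true lo.
  by have [[/= _ ? _ _] _ _ _] := W; lra.
by exists i.
Qed.

Lemma wall_unique n (R : rectangulation K n) s s' i : is_wall R s -> is_wall R s' ->
  seg_dir s = seg_dir s' -> touches R s true i -> touches R s' true i -> s = s'.
Proof.
case: s s' => [[] c lo hi] [d c' lo' hi'] W W' /= e; rewrite -{}e in W' * => h h'.
  move: W W' h h' => /vwall_reflect W /vwall_reflect W'.
  move=> /(on_vwall_reflect _ _ _ _ false) h /(on_vwall_reflect _ _ _ _ false) h'.
  have [/= /oppr_inj-> /oppr_inj-> /oppr_inj->] := vwall_unique W W' h h'.
  by [].
by have [/= -> -> ->] := vwall_unique W W' h h'.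
Qed.

Section JointTransport.

Variables (n : nat) (f : 'I_n -> 'I_n) (R S : rectangulation K n).
Hypothesis fRS : relabels f R S.
Variables (w w' : segment K).
Hypotheses (W : is_wall R w) (W' : is_wall S w') (ww' : corresponds f R S w w').
Hypothesis wv : seg_dir w = Vertical.

Lemma t_joint_transport_vertical s s' t : is_wall R s -> is_wall S s' ->
  corresponds f R S s s' -> t_joint s w t -> t_joint s' w' t.
Proof.
move=> Ws Ws' [ds hs] tj; have [sh e lh] := t_joint_vertical wv tj.
have [dw hw] := ww'; rewrite wv in dw; rewrite sh in ds.
move: W W' Ws Ws' hs hw; rewrite /is_wall /touches wv dw ds sh => V V' H H' hs hw.
have [i [j [/hw wi /hw wj /hs si /hs sj]]] := joint_cells V H e lh.
have [e' lh'] := cells_joint V' H' wi wj si sj.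
split=> //; rewrite ds dw; move: e e' tj {wi wj}.
by case: t => e e' [_]; rewrite wv sh => -[].

Qed.

Lemma joint_before_transport_vertical s1 s1' s2 s2' :
  is_wall R s1 -> is_wall S s1' -> corresponds f R S s1 s1' ->
  is_wall R s2 -> is_wall S s2' -> corresponds f R S s2 s2' ->
  joint_before w s1 s2 -> joint_before w' s1' s2'.
Proof.
move=> W1 W1' c1 W2 W2' c2 [[t1 j1] [t2 j2] lt21]; have [dw hw] := ww'.
split.
- by exists t1; apply: t_joint_transport_vertical j1.
- by exists t2; apply: t_joint_transport_vertical j2.
move: lt21; rewrite dw wv => lt21.
have [sh1 e1 lh1] := t_joint_vertical wv j1.
have [sh2 e2 lh2] := t_joint_vertical wv j2.
have [d1 h1] := c1; have [d2 h2] := c2; rewrite sh1 in d1; rewrite sh2 in d2.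
rewrite wv in dw.
move: W W' W1 W1' W2 W2' h1 h2 hw.
rewrite /is_wall /touches wv dw d1 d2 sh1 sh2 => V V' H1 H1' H2 H2' h1 h2 hw.
(* The upper stem is represented by the cell under it and the lower stem by the cell on it, in the
   form that [vwall_order] compares. *)
have [_ [j [_ wj _ hj]]] := joint_cells V H1 e1 lh1.
have [k [_ [wk _ hk _]]] := joint_cells V H2 e2 lh2.
have [ja _ _] := hj; have [ka _ _] := hk.
have [ja' _ _] := h1 _ _ hj; have [ka' _ _] := h2 _ _ hk.
by rewrite -ja' -ka'; apply: (vwall_order fRS V wj wk); rewrite ja ka.
Qed.

End JointTransport.

Section JointTransportAll.

Variables (n : nat) (f : 'I_n -> 'I_n) (R S : rectangulation K n).
Hypothesis fRS : relabels f R S.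
Variables (w w' : segment K).
Hypotheses (W : is_wall R w) (W' : is_wall S w') (ww' : corresponds f R S w w').

Lemma t_joint_transport s s' t : is_wall R s -> is_wall S s' ->
  corresponds f R S s s' -> t_joint s w t -> t_joint s' w' t.
Proof.
case dw: (seg_dir w) => Ws Ws' ss'; last exact: (t_joint_transport_vertical W W' ww').
move=> /t_joint_reflect tj.
rewrite -[s']reflect_segmentK -[w']reflect_segmentK -[t]reflect_jointK.
apply: t_joint_reflect; move: tj.
apply: (@t_joint_transport_vertical _ f (reflect R) (reflect S)).
- exact/is_wall_reflect.
- exact/is_wall_reflect.
- exact: corresponds_reflect ww'.
- by rewrite /= dw.
- exact/is_wall_reflect.
- exact/is_wall_reflect.
- exact: corresponds_reflect ss'.
Qed.

Lemma joint_before_transport s1 s1' s2 s2' :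
  is_wall R s1 -> is_wall S s1' -> corresponds f R S s1 s1' ->
  is_wall R s2 -> is_wall S s2' -> corresponds f R S s2 s2' ->
  joint_before w s1 s2 -> joint_before w' s1' s2'.
Proof.
case dw: (seg_dir w) => W1 W1' c1 W2 W2' c2; last first.
  exact: (joint_before_transport_vertical fRS W W' ww').
move=> /joint_before_reflect jb; rewrite -[w']reflect_segmentK.
rewrite -[s1']reflect_segmentK -[s2']reflect_segmentK.
apply: joint_before_reflect; move: jb.
apply: (joint_before_transport_vertical (relabels_reflect fRS)).
- exact/is_wall_reflect.
- exact/is_wall_reflect.
- exact: corresponds_reflect ww'.
- by rewrite /= dw.
- exact/is_wall_reflect.
- exact/is_wall_reflect.
- exact: corresponds_reflect c1.
- exact/is_wall_reflect.
- exact/is_wall_reflect.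
- exact: corresponds_reflect c2.
Qed.

End JointTransportAll.

Lemma contains_equivalent n (R S : rectangulation K n) P :
  equivalent R S -> contains R P -> contains S P.
Proof.
move=> [f fRS] [g [injg wg jg bg]].
have gW a : is_wall R (g a) by apply/wallP; case: (wg a).
have /fin_all_exists2[g' g'W gg'] a := wall_transport fRS (gW a).
have invf : relabels (f^-1)%g S R.
  move=> i j; have [h1 h2] := fRS ((f^-1%g i)) ((f^-1%g j)).
  by rewrite -h1 -h2 !permKV.
exists g'; split.
- move=> a b eab; apply: injg.
  have [u uW ug] := wall_transport invf (g'W a).
  (* Transporting [g' a] back along the inverse relabelling gives one wall [u] of R. Any [g c] with
     the same image touches a common cell with [u], hence equals it. *)
  have E c : g' a = g' c -> g c = u.
    move=> ac; have [i ic] := wall_touched (gW c).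
    have [dc /(_ _ _ ic) hc] := gg' c; have [du hu] := ug.
    apply: wall_unique (gW c) uW _ ic _; first by rewrite du ac dc.
    by have := hu true (f i); rewrite permK ac; apply.
  by rewrite !E.
- by move=> a; split; [apply/wallP|rewrite (proj1 (gg' a)); case: (wg a)].
- by move=> a b t /jg; apply: t_joint_transport.
- by move=> w a b /bg; apply: joint_before_transport.
Qed.

End Relabelling.

(** * Deletion *)

Section Deletion.

Variables (K : realFieldType) (n : nat).
Variables (R : rectangulation K n.+1) (S : rectangulation K n) (r : 'I_n.+1).

Local Notation q := (cell R r).
Local Notation a := (xl (cell R r)).
Local Notation t := (yt (cell R r)).
Local Notation X0 := (xl (box R)).
Local Notation X1 := (xr (box R)).
Local Notation Y0 := (yb (box R)).
Local Notation Y1 := (yt (box R)).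

Hypotheses (r_bottom : touches_bottom R r) (r_right : touches_right R r).
Hypothesis box_eq : box S = box R.
Hypothesis r_arm : arm R StemUp a t.
Hypothesis cell_eq : forall j : 'I_n, let s := cell R (lift r j) in
  cell S j = if below R r (lift r j) then Rect (xl s) (xr s) (yb q) (yt s) else s.

Lemma deleted_cell : [/\ yb q = Y0, xr q = X1, a < X1 & Y0 < t].
Proof.
have [? ?] := cell_lt R r.
by move: r_bottom r_right => /eqP ? /eqP ?; split=> //; lra.
Qed.

(** The arm that leaves the top-left vertex of [r] upwards keeps cells from crossing the line x =
    [a] just above [r]. A cell on top of [r] thus starts no further left than [r]. *)
Lemma arm_clear : exists2 h, t < h <= Y1 &
  forall i, xl (cell R i) < a < xr (cell R i) ->
    yt (cell R i) <= t \/ h <= yb (cell R i).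
Proof.
case: r_arm => -[d c lo h] /line_segmentP[/= lh _ inb cl] [dv ca lot].
subst d c lo; exists h; last exact: vertical_clear.
have := inb a h; rewrite /on_segment /in_rect /= eqxx lexx andbT.
by move=> /(_ (ltW lh)); lra.
Qed.

(** The case distinction behind all that follows: a cell of S was stretched down to the box, or it
    is unchanged and then lies to the left of [a] or starts strictly above the top of [r]. *)
Lemma remaining_cell j : let s := cell S j in let s0 := cell R (lift r j) in
  [/\ xl s = xl s0, xr s = xr s0, yt s = yt s0 &
      [/\ yb s = Y0, yb s0 = t & a <= xl s0] \/
      yb s = yb s0 /\ (xr s0 <= a \/ t < yb s0)].
Proof.
have [qb qr aX Yt] := deleted_cell; have [h th clear] := arm_clear.
have [? ?] := cell_lt R (lift r j); have [? ? ? ?] := cell_in_box R (lift r j).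
rewrite /= cell_eq; case: ifPn => [/belowP[h1 h2 h3]|/belowP nb]; split=> //=.
  left; split=> //; rewrite leNgt; apply/negP => ?.
  by have := clear (lift r j); lra.
right; split=> //; case: (lerP (xr (cell R (lift r j))) a) => ra; [by left|right].
case: (cells_apart R (neq_lift r j)) => ?; try lra.
rewrite lt_neqAle; apply/andP; split=> //; apply/eqP => e.
by apply: nb; split; lra.
Qed.

Lemma remaining_cases i : i = r \/ exists j, i = lift r j.
Proof. by case: (unliftP r i) => [j ->|->]; [right; exists j|left]. Qed.

(** To the right of [a] and up to height [t], S consists of stretched cells only; each of them
    reaches from the bottom of the box to above [t] and leaves no room for a horizontal wall. *)
Lemma low_hwall y l h : hwall S y l h -> y <= t -> h <= a.
Proof.
move=> [[yin lh lin hin] clear _ _] yt'; rewrite leNgt; apply/negP => ah.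
have [x [x1 x2 x3]] : exists x, [/\ l <= x, a <= x & x < h].
  by case: (leP l a) => ?; [exists a|exists l]; split; lra.
have [qb qr aX Yt] := deleted_cell; rewrite box_eq in yin lin hin.
have [||j [jx jy]] := @cell_NE _ _ S x y; rewrite ?box_eq; try lra.
have [e1 e2 e3 e4] := remaining_cell j; have [_ ?] := cell_lt R (lift r j).
case: e4 => [[? ? ?]|[? [?|?]]]; try lra.
by have := clear j; lra.
Qed.

(** To the right of [a], cells of S end above [t] and start on the bottom of the box or above [t],
    so that nothing can block a vertical wall at an intermediate height. *)
Lemma extended_vwall c lo hi : vwall S c lo hi -> a < c ->
  t < hi /\ (lo < t -> lo = Y0).
Proof.
move=> [[cin lohi loin hiin] _ wlo whi] ac.
have [h th _] := arm_clear; have [qb qr aX Yt] := deleted_cell.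
rewrite box_eq in loin hiin wlo whi; split.
  case: whi => [|[j cj jh]]; first lra.
  have [e1 e2 e3 e4] := remaining_cell j.
  by case: e4 => [[? ? ?]|[? [?|?]]]; lra.
move=> lot; case: wlo => [//|[j cj jh]].
have [e1 e2 e3 e4] := remaining_cell j; have [_ ?] := cell_lt R (lift r j).
by case: e4 => [[? ? ?]|[? [?|?]]]; lra.
Qed.

(* Sliding the top side of [q] downwards stretches the vertical walls that ended
   at it down to the box. *)
Definition retracted_end (c lo : K) : K := if (a < c) && (lo == Y0) then t else lo.

Lemma vwall_before_deletion c lo hi :
  vwall S c lo hi -> vwall R c (retracted_end c lo) hi.
Proof.
move=> W; have ext := extended_vwall W; case: W => -[].
rewrite box_eq => cin lohi loin hiin clear wlo whi.
have [h th _] := arm_clear; have [qb qr aX Yt] := deleted_cell.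
set lo' := retracted_end c lo.
have lo'E : a < c /\ lo = Y0 /\ lo' = t \/ lo' = lo /\ (a < c -> t <= lo).
  rewrite /lo' /retracted_end; case: (ltrP a c) => ac; last by right; split=> //; lra.
  have [? lt] := ext ac; case: eqVneq => [->|lY] /=; first by left.
  by right; split=> // _; rewrite leNgt; apply/negP => /lt/eqP; apply/negP.
have lole : lo <= lo' by case: lo'E => [[? [? ?]]|[? ?]]; lra.
have lo'hi : lo' < hi.
  by case: lo'E => [[/ext[? _] [? ?]]|[? ?]]; lra.
split.
- by split=> //; lra.
- move=> i ci; case: (remaining_cases i) => [ir|[j ij]]; subst i.
    left; case: lo'E => [[? [? ?]]|[-> tl]]; first lra.
    by apply: tl; lra.
  have [e1 e2 e3 e4] := remaining_cell j.
  have [||] := clear j; [lra|by rewrite e3 => ?; left; lra|move=> hj; right].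
  by case: e4 => [[? ? ?]|[? _]]; lra.
- case: lo'E => [[ac [_ ->]]|[-> lol]].
    by right; exists r => //; lra.
  case: wlo => [|[j cj jl]]; [by left|right].
  by have [e1 e2 e3 e4] := remaining_cell j; exists (lift r j); lra.
- case: whi => [|[j cj jh]]; [by left|right].
  have [e1 e2 e3 e4] := remaining_cell j; exists (lift r j); first lra.
  by case: e4 => [[? ? ?]|[? _]]; lra.
Qed.

(** In R such a wall would meet the top side of [r] end to end, and the four cells around the
    top-left vertex of [r] would share that point. *)
Lemma no_wall_to_joint l : ~ hwall S t l a.
Proof.
move=> [[tin lh lin _] clear _ _]; rewrite box_eq in tin lin.
have [qb qr aX Yt] := deleted_cell; have [h th aclear] := arm_clear.
have [||k [kx ky]] := @cell_NW _ _ R a t; try lra.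
have [||m [mx my]] := @cell_SW _ _ R a t; try lra.
have [||e [ex ey]] := @cell_NE _ _ R a t; try lra.
have ea : xl (cell R e) = a by have := aclear e; clear - ex ey th; lra.
have ka : xr (cell R k) = a by have := aclear k; clear - kx ky th; lra.
have ma : xr (cell R m) = a.
  case: (ltrP a (xr (cell R m))) => am; last lra.
  have cm : xl (cell R m) < a < xr (cell R m) by lra.
  by case: (@crossing_apart _ _ R r m a cm (or_introl erefl)) => ?; lra.
have kt : yb (cell R k) = t.
  case: (remaining_cases k) => [kr|[p kp]]; subst k; first lra.
  have [f1 f2 f3 f4] := remaining_cell p; have := clear p.
  by case: f4 => [[? ? ?]|[? _]]; lra.
have re : r <> e by move=> E; rewrite -E in ey; lra.
have mk : m <> k by move=> E; rewrite E in my; lra.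
by apply: mk; apply: (@no_cross _ _ R true a t r e) => //; try lra; apply/eqP.
Qed.

Lemma hwall_before_deletion y l h : hwall S y l h -> hwall R y l h.
Proof.
move=> H; have low := low_hwall H; have [[]] := H.
rewrite box_eq => yin lh lin hin clear wlo whi.
have [qb qr aX Yt] := deleted_cell.
split=> //.
- move=> i ci; case: (remaining_cases i) => [ir|[j ij]]; subst i.
    by right; apply: low; lra.
  have [e1 e2 e3 e4] := remaining_cell j.
  have : yb (cell S j) < y < yt (cell S j) by case: e4 => [[? ? ?]|[? _]]; lra.
  by move=> /clear; lra.
- case: wlo => [|[j cj jl]]; [by left|right].
  have [e1 e2 e3 e4] := remaining_cell j; have [? _] := cell_lt R (lift r j).
  exists (lift r j); last lra.
  case: e4 => [[? ? ?]|[? _]]; last lra.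
  by case: (ltrP t y) => [?|/low ?]; lra.
- case: whi => [|[j cj jh]]; [by left|right].
  have [e1 e2 e3 e4] := remaining_cell j; have [? _] := cell_lt R (lift r j).
  (* A stretched cell may block the wall at a height that [r] occupied. The end is then at [a], and
     in R the cell [r] blocks it instead, unless y = [t], which [no_wall_to_joint] excludes. *)
  case: e4 => [[? jt ?]|[? _]]; last by exists (lift r j); lra.
  case: (ltrP t y) => [?|yt']; first by exists (lift r j); lra.
  have ha : h = a by have := low yt'; lra.
  case: (ltrP y t) => yt''; first by exists r; lra.
  have {yt' yt''} ey : y = t by lra.
  by case: (@no_wall_to_joint l); move: H; rewrite ey ha.
Qed.

Definition undeleted (s : segment K) : segment K :=
  match seg_dir s with
  | Vertical =>
    Segment Vertical (seg_at s) (retracted_end (seg_at s) (seg_lo s)) (seg_hi s)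
  | Horizontal => s
  end.

Lemma undeleted_wall s : is_wall S s -> is_wall R (undeleted s).
Proof.
by case: s => [[] c lo hi]; [apply: hwall_before_deletion|apply: vwall_before_deletion].
Qed.

Lemma undeletedE s : [/\ seg_dir (undeleted s) = seg_dir s,
  seg_at (undeleted s) = seg_at s & seg_hi (undeleted s) = seg_hi s].
Proof. by case: s => [[] c lo hi]. Qed.

(** Retracting may change the lower end of a vertical wall, but its line and upper end already
    determine a wall of S. *)
Lemma undeleted_inj s s' : is_wall S s -> is_wall S s' ->
  undeleted s = undeleted s' -> s = s'.
Proof.
have aux c lo hi lo' : vwall S c lo hi -> vwall S c lo' hi -> lo <= lo'.
  move=> [[_ lohi loin _] _ wlo _] [[_ lohi' loin' _] clear' _ _].
  rewrite leNgt; apply/negP => h; case: wlo => [|[k /clear' ck ky]]; first lra.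
  by have [_ ?] := cell_lt S k; lra.
case: s s' => [[] c lo hi] [[] c' lo' hi'] W W' //.
case=> ec _ ehi; move: W W'; rewrite /is_wall /= -ec -ehi => W W'.
by congr Segment; apply/eqP; rewrite eq_le !(aux c _ hi).
Qed.

(** A vertical wall is shortened only to the right of [a] and up to height [t], where by [low_hwall]
    no horizontal wall ends at it. As a stem it is shortened only if it reaches the bottom of the
    box, which is not a wall. *)
Lemma t_joint_undeleted s w u : is_wall S s -> is_wall S w ->
  t_joint s w u -> t_joint (undeleted s) (undeleted w) u.
Proof.
case: s w => [[] sa sl sh] [[] wa wl wh] Ws Ww [hs];
  case: u => -[] //= _ _ e; split; rewrite /= ?e //.
- rewrite /retracted_end; case: ifP => // /andP[aw /eqP wY]; apply/andP.
  split; last by move: hs => /=; lra.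
  rewrite ltNge; apply/negP => /(low_hwall Ws) /=.
  by have [[_ /= ? _ _] _ _ _] := Ws; lra.
- rewrite /retracted_end; case: ifP => // /andP[aw /eqP wY]; apply/andP.
  split; last by move: hs => /=; lra.
  by rewrite ltNge; apply/negP => /(low_hwall Ws) /=; lra.
- split=> //; rewrite /retracted_end; case: ifP => // /andP[_ /eqP sY].
  by have [[/= + _ _ _] _ _ _] := Ww; rewrite box_eq; lra.
Qed.

Lemma contains_before_vertical_deletion P : contains S P -> contains R P.
Proof.
case=> g [injg wg jg bg]; have gW b : is_wall S (g b) by apply/wallP; case: (wg b).
exists (undeleted \o g); split=> /=.
- by move=> b b' /undeleted_inj e; apply: injg; apply: e.
- move=> b; split; first by apply/wallP/undeleted_wall.
  by have [-> _ _] := undeletedE (g b); case: (wg b).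
- by move=> b b' u /jg; apply: t_joint_undeleted.
- move=> w b b' /bg[[u ju] [u' ju'] lt]; split.
  + by exists u; apply: t_joint_undeleted.
  + by exists u'; apply: t_joint_undeleted.
  + have [-> _ _] := undeletedE (g w); have [_ -> _] := undeletedE (g b).
    by have [_ -> _] := undeletedE (g b').
Qed.

End Deletion.

(** If the left side of [r] slides, the reflected drawing has the other kind of deletion, and the
    arm to the left becomes the arm upwards. *)
Lemma contains_before_deletion (K : realFieldType) n (R : rectangulation K n.+1)
    (S : rectangulation K n) P : deletes R S -> contains S P -> contains R P.
Proof.
case=> r [rb rr eb [[[_ vt] ec]|[[_ vt] ec]]].
  have /vt a : StemUp <> opposite StemRight by [].
  exact: (contains_before_vertical_deletion rb rr eb a ec).
have /vt [s ls [sd sa sh]] : StemLeft <> opposite StemDown by [].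
move=> /reflect_contains h; apply: contains_reflectK; move: h.
apply: (@contains_before_vertical_deletion _ _ (reflect R) (reflect S) r).
- by rewrite /touches_bottom /= eqr_opp.
- by rewrite /touches_right /= eqr_opp.
- by rewrite /= eb.
- exists (reflect_segment s); first exact/line_segment_reflect.
  by rewrite /= sd sa sh.
- by move=> j; rewrite below_reflect /= ec; case: ifP.
Qed.

(** * The first child *)

(** Insertion points have to be strictly increasing, whereas [sort] needs a total relation; sorting
    by the reflexive closure and excluding repetitions gives strictness. *)
Lemma strict_sort (T : eqType) (e : rel T) (s : seq T) :
  transitive e -> (forall x y, x != y -> e x y || e y x) -> uniq s ->
  exists2 s', perm_eq s' s & sorted e s'.
Proof.
move=> tr_e tot_e us; pose e' x y := (x == y) || e x y.
have tot_e' : total e'.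
  move=> x y; rewrite /e'; case: (eqVneq x y) => //= xy; exact: tot_e.
exists (sort e' s); first by rewrite perm_sort.
have := sort_sorted tot_e' s; have : uniq (sort e' s) by rewrite sort_uniq.
case: (sort e' s) => //= x {us}s; elim: s x => //= y s IH x /andP[xs ys].
move=> /andP[xy p]; rewrite (IH _ ys p) andbT.
by case/orP: xy => // /eqP xy; rewrite xy mem_head in xs.
Qed.

(** Being an insertion edge is a proposition without a given decision procedure, so that the finite
    list of such edges comes from excluded middle. *)
Lemma classical_filter (T : eqType) (P : T -> Prop) (s : seq T) :
  exists2 s', uniq s' & forall x, x \in s' <-> x \in s /\ P x.
Proof.
elim: s => [|x s [s' us' IH]]; first by exists [::] => // x; split=> // -[].
case: (classic (P x)) => [Px|nPx]; last first.
  exists s' => // y; rewrite IH inE; split=> [[-> //]|]; first by rewrite orbT.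
  by case=> /orP[/eqP->|].
exists (undup (x :: s')); first exact: undup_uniq.
move=> y; rewrite mem_undup !inE; split=> [/orP[/eqP->|/IH[-> ?]]|].
- by rewrite eqxx.
- by rewrite orbT.
- by case=> /orP[->//|ys Py]; apply/orP; right; apply/IH.
Qed.

(** * Edges and insertion points *)

Section Edges.

Variables (K : realFieldType) (n : nat) (R : rectangulation K n).

(** If two overlapping edges had different ends, cutting one of them at an end of the other would
    give a shorter line segment, against minimality. *)
Lemma edge_unique e e' x y : edge R e -> edge R e' -> seg_dir e = seg_dir e' ->
  inside_segment e x y -> inside_segment e' x y -> e = e'.
Proof.
have lo_le d a l h l' h' : edge R (Segment d a l h) -> edge R (Segment d a l' h') ->
    l' < h -> l' <= l.
  move=> [[/= lh v b] m] [[/= lh' v' b'] m'] l'h; rewrite leNgt; apply/negP => ll'.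
  have [] : Segment d a l l' = Segment d a l h; last lra.
  case: d v b m v' b' m' => v b m v' b' m'; apply: m.
  - split=> //= u w.
    + rewrite /endpoint /= => /andP[wa /orP[ul|ul]].
        by apply: v; rewrite /endpoint /= wa ul.
      by apply: v'; rewrite /endpoint /= wa ul.
    + by move=> uw; apply: b; move: uw; rewrite /on_segment /=; lra.
  - by move=> u w; rewrite /on_segment /=; lra.
  - split=> //= u w.
    + rewrite /endpoint /= => /andP[wa /orP[ul|ul]].
        by apply: v; rewrite /endpoint /= wa ul.
      by apply: v'; rewrite /endpoint /= wa ul.
    + by move=> uw; apply: b; move: uw; rewrite /on_segment /=; lra.
  - by move=> u w; rewrite /on_segment /=; lra.
have hi_le d a l h l' h' : edge R (Segment d a l h) -> edge R (Segment d a l' h') ->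
    l < h' -> h <= h'.
  move=> [[/= lh v b] m] [[/= lh' v' b'] m'] l'h; rewrite leNgt; apply/negP => ll'.
  have [] : Segment d a h' h = Segment d a l h; last lra.
  case: d v b m v' b' m' => v b m v' b' m'; apply: m.
  - split=> //= u w.
    + rewrite /endpoint /= => /andP[wa /orP[ul|ul]].
        by apply: v'; rewrite /endpoint /= wa ul orbT.
      by apply: v; rewrite /endpoint /= wa ul orbT.
    + by move=> uw; apply: b; move: uw; rewrite /on_segment /=; lra.
  - by move=> u w; rewrite /on_segment /=; lra.
  - split=> //= u w.
    + rewrite /endpoint /= => /andP[wa /orP[ul|ul]].
        by apply: v'; rewrite /endpoint /= wa ul orbT.
      by apply: v; rewrite /endpoint /= wa ul orbT.
    + by move=> uw; apply: b; move: uw; rewrite /on_segment /=; lra.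
  - by move=> u w; rewrite /on_segment /=; lra.
case: e e' => [d a l h] [d' a' l' h'] E E' /= dd; subst d'.
rewrite /inside_segment /= => i i'.
have aa : a = a' by case: d i i' {E E'} => /andP[/eqP<- _] /andP[/eqP<- _].
subst a'; have [lh' l'h] : l < h' /\ l' < h by case: d i i' {E E'} => ? ?; lra.
congr Segment; apply/eqP; rewrite eq_le.
  by rewrite (lo_le _ _ _ _ _ _ E' E) // (lo_le _ _ _ _ _ _ E E').
by rewrite (hi_le _ _ _ _ _ _ E' E) // (hi_le _ _ _ _ _ _ E E').
Qed.

Definition coordinates : seq K :=
  flatten [seq [:: xl (cell R i); xr (cell R i); yb (cell R i); yt (cell R i)]
          | i <- enum 'I_n].

Lemma mem_coordinates i : [/\ xl (cell R i) \in coordinates,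
  xr (cell R i) \in coordinates, yb (cell R i) \in coordinates
  & yt (cell R i) \in coordinates].
Proof.
by split; apply/flatten_mapP; exists i; rewrite ?mem_enum // !inE eqxx ?orbT.
Qed.

Lemma vertex_coordinates x y : vertex R x y -> x \in coordinates /\ y \in coordinates.
Proof.
case/existsP=> i /andP[]; have [? ? ? ?] := mem_coordinates i.
by move=> /orP[/eqP->|/eqP->] /orP[/eqP->|/eqP->].
Qed.

Lemma edge_coordinates e : edge R e ->
  [/\ seg_at e \in coordinates, seg_lo e \in coordinates & seg_hi e \in coordinates].
Proof.
case: e => [[] a l h] [[/= _ v _] _].
  have := v l a; have := v h a; rewrite /endpoint /= !eqxx orbT /=.
  by move=> /(_ isT)/vertex_coordinates[-> ->] /(_ isT)/vertex_coordinates[-> _].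
have := v a l; have := v a h; rewrite /endpoint /= !eqxx orbT /=.
by move=> /(_ isT)/vertex_coordinates[-> ->] /(_ isT)/vertex_coordinates[_ ->].
Qed.

(** Edges end in vertices, so finitely many triples of position and ends come into question. The
    chosen points are midpoints; by [edge_unique] a midpoint is inside no other edge of the
    family. *)
Lemma exists_one_point_on_each d (E : segment K -> Prop) :
  (forall e, E e -> edge R e /\ seg_dir e = d) ->
  exists2 qs, uniq qs & one_point_on_each E qs.
Proof.
move=> Ed; pose seg (p : K * K * K) := Segment d p.1.1 p.1.2 p.2.
pose mid (p : K * K * K) : K * K := let m := (p.1.2 + p.2) / 2 in
  match d with Vertical => (p.1.1, m) | Horizontal => (m, p.1.1) end.
pose cs := coordinates.
have [es ues esP] := classical_filter (E \o seg)
  [seq (p, z) | p <- [seq (x, y) | x <- cs, y <- cs], z <- cs].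
have esE p : p \in es <-> E (seg p).
  split=> [/esP[]//|Ep]; apply/esP; split=> //.
  have [/edge_coordinates[/= h1 h2 h3] _] := Ed _ Ep.
  case: p h1 h2 h3 {Ep} => [[x y] z] /= h1 h2 h3.
  by apply: allpairs_f => //; apply: allpairs_f.
have inside p : p \in es -> inside_segment (seg p) (mid p).1 (mid p).2.
  move=> /esE/Ed[[[/= lh _ _] _] _]; rewrite /inside_segment /mid /=.
  by case: d {Ed seg mid esP esE} => /=; rewrite eqxx /=; lra.
have same p p' : p \in es -> p' \in es ->
    inside_segment (seg p) (mid p').1 (mid p').2 -> p = p'.
  move=> pe pe' i; have i' := inside _ pe'.
  have [E1 _] := Ed _ (proj1 (esE _) pe); have [E2 _] := Ed _ (proj1 (esE _) pe').
  have [] := edge_unique E1 E2 erefl i i'.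
  by case: p p' {pe pe' i i' E1 E2} => [[? ?] ?] [[? ?] ?] /= -> -> ->.
exists [seq mid p | p <- es].
  rewrite map_inj_in_uniq // => p p' pe pe' e; apply: same => //.
  by rewrite -e; apply: inside.
split=> [q /mapP[p pe ->]|e Ee].
  by exists (seg p); [apply/esE|apply: inside].
have [_ de] := Ed _ Ee; pose p := (seg_at e, seg_lo e, seg_hi e).
have ep : e = seg p by rewrite /seg /p -de; case: (e).
have pe : p \in es by apply/esE; rewrite -ep.
rewrite count_map (@eq_in_count _ _ (pred1 p)); last first.
  move=> p' pe' /=; rewrite ep; apply/idP/eqP => [i|->]; last exact: inside.
  by rewrite (same p p').
by rewrite count_uniq_mem // pe.
Qed.

(** No other cell has a corner strictly inside this side, which lies on the box. It is the edge that
    carries the first insertion point. *)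
Lemma bottom_left_edge k :
  xl (cell R k) = xl (box R) -> yb (cell R k) = yb (box R) ->
  edge R (Segment Vertical (xl (box R)) (yb (box R)) (yt (cell R k))).
Proof.
move=> kX kY; have [xk yk] := cell_lt R k; split=> [|[d a l r] [/= lr v _] sub].
  split=> /= [|x y|x y]; first lra.
    rewrite /endpoint /= => exy; apply/existsP; exists k.
    by rewrite /is_corner kX kY; move: exy; rewrite !eq_le; lra.
  rewrite /on_segment /= => sxy; apply/existsP; exists k.
  by rewrite /on_boundary /in_rect /in_interior kX kY; lra.
case: d v sub => v sub.
  exfalso; have := sub l a; have := sub r a; rewrite /on_segment /=.
  by clear - lr; lra.
have := sub a l; have := sub a r; rewrite /on_segment /= => s1 s2.
have aX : a = xl (box R) by clear - lr s1 s2; lra.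
have {s1 s2} [lY rk] : yb (box R) <= l /\ r <= yt (cell R k).
  by clear - lr s1 s2; split; lra.
have corner y : yb (box R) <= y <= yt (cell R k) -> vertex R a y ->
    y = yb (box R) \/ y = yt (cell R k).
  move=> hy /existsP[i]; rewrite /is_corner aX => c.
  have [xi yi] := cell_lt R i; have [b1 _ b3 _] := cell_in_box R i.
  case: (eqVneq k i) => [ki|/(cells_apart R)]; first by rewrite -ki in c; lra.
  by clear - c hy kX kY xk yk xi yi b1 b3; case=> ?; lra.
have vl : vertex R a l by apply: v; rewrite /endpoint /= !eqxx.
have vr : vertex R a r by apply: v; rewrite /endpoint /= !eqxx orbT.
have hl : yb (box R) <= l <= yt (cell R k) by clear - lY rk lr; lra.
have hr : yb (box R) <= r <= yt (cell R k) by clear - lY rk lr; lra.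
have le : l = yb (box R).
  by case: (corner l hl vl) => //; clear - lr rk; lra.
have re : r = yt (cell R k).
  by case: (corner r hr vr) => //; clear - lr lY; lra.
by rewrite aX le re.
Qed.

Lemma one_point_on_each_perm E qs qs' : perm_eq qs' qs ->
  one_point_on_each E qs -> @one_point_on_each K E qs'.
Proof.
move=> pq [h1 h2]; split=> [q|e Ee]; first by rewrite (perm_mem pq); apply: h1.
by rewrite (seq.permP pq); apply: h2.
Qed.

End Edges.

Lemma lex_xy_trans (K : realFieldType) : transitive (@lex_xy K).
Proof. by move=> [? ?] [? ?] [? ?]; rewrite /lex_xy /= => ? ?; lra. Qed.

Lemma lex_yx_trans (K : realFieldType) : transitive (@lex_yx K).
Proof. by move=> [? ?] [? ?] [? ?]; rewrite /lex_yx /= => ? ?; lra. Qed.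

Lemma lex_xy_total (K : realFieldType) (p q : K * K) :
  p != q -> lex_xy p q || lex_xy q p.
Proof.
case: p q => [x y] [x' y']; rewrite xpair_eqE /lex_xy /=.
by case: (ltgtP x x') => //= _; case: (ltgtP y y').
Qed.

Lemma lex_yx_total (K : realFieldType) (p q : K * K) :
  p != q -> lex_yx p q || lex_yx q p.
Proof.
case: p q => [x y] [x' y']; rewrite xpair_eqE /lex_yx /=.
by rewrite andbC; case: (ltgtP y y') => //= _; case: (ltgtP x x').
Qed.

(** * A strip along the bottom as first child *)

Section FirstChild.

Variables (K : realFieldType) (n : nat) (R : rectangulation K n).
Implicit Types (i j k : 'I_n).

Local Notation x0 i := (xl (cell R i)).
Local Notation x1 i := (xr (cell R i)).
Local Notation y0 i := (yb (cell R i)).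
Local Notation y1 i := (yt (cell R i)).
Local Notation X0 := (xl (box R)).
Local Notation X1 := (xr (box R)).
Local Notation Y0 := (yb (box R)).
Local Notation Y1 := (yt (box R)).

Variable h : K.
Hypothesis h_range : Y0 < h < Y1.
Hypothesis h_low : forall i, h < y1 i /\ (y0 i = Y0 \/ h < y0 i).

Definition raised_cell j : rect K :=
  if touches_bottom R j then Rect (x0 j) (x1 j) h (y1 j) else cell R j.

Definition child_cell (i : 'I_n.+1) : rect K :=
  if unlift ord_max i is Some j then raised_cell j else Rect X0 X1 Y0 h.

Lemma child_cell_max : child_cell ord_max = Rect X0 X1 Y0 h.
Proof. by rewrite /child_cell unlift_none. Qed.

Lemma child_cell_lift j : child_cell (lift ord_max j) = raised_cell j.
Proof. by rewrite /child_cell liftK. Qed.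

Lemma raised_cellP j : let s := raised_cell j in
  [/\ xl s = x0 j, xr s = x1 j, yt s = y1 j &
      [/\ touches_bottom R j, yb s = h & y0 j = Y0] \/
      [/\ ~~ touches_bottom R j, yb s = y0 j & h < y0 j]].
Proof.
rewrite /raised_cell; case: ifPn => /= [jb|jb]; split=> //.
  by left; split=> //; apply/eqP.
by right; split=> //; case: (h_low j) => _ [/eqP|//]; rewrite -[_ == _]/(touches_bottom R j) (negPf jb).
Qed.

Lemma child_cell_nondegenerate (i : 'I_n.+1) : nondegenerate (child_cell i).
Proof.
have [? ?] := box_lt R; have hY := h_range; rewrite /nondegenerate.
case: (unliftP ord_max i) => [j ->|->]; last by rewrite child_cell_max /=; lra.
have [? ?] := cell_lt R j; have [? _] := h_low j.
by rewrite child_cell_lift; have [-> -> -> [[_ -> ?]|[_ -> ?]]] := raised_cellP j; lra.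
Qed.

Lemma child_cell_cover x y :
  in_rect (box R) x y = [exists i, in_rect (child_cell i) x y].
Proof.
have hY := h_range; apply/idP/existsP => [b|[i]].
  case: (lerP y h) => hy.
    by exists ord_max; rewrite child_cell_max; move: b; rewrite /in_rect /=; lra.
  move: b; rewrite cell_cover => /existsP[j jxy]; exists (lift ord_max j).
  rewrite child_cell_lift; move: jxy; rewrite /in_rect.
  by have [-> -> -> [[_ -> ?]|[_ -> ?]]] := raised_cellP j; lra.
case: (unliftP ord_max i) => [j ->|->].
  have [? ? ? ?] := cell_in_box R j; rewrite child_cell_lift /in_rect.
  by have [-> -> -> [[_ -> ?]|[_ -> ?]]] := raised_cellP j; lra.
by rewrite child_cell_max /in_rect /=; lra.
Qed.

Lemma child_cell_disjoint (i i' : 'I_n.+1) x y : i != i' ->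
  ~~ (in_interior (child_cell i) x y && in_interior (child_cell i') x y).
Proof.
have hY := h_range.
have sub j : in_interior (child_cell (lift ord_max j)) x y ->
    in_interior (cell R j) x y /\ h < y.
  rewrite child_cell_lift /in_interior.
  by have [-> -> -> [[_ -> ?]|[_ -> ?]]] := raised_cellP j => ?; split; lra.
have low : in_interior (child_cell ord_max) x y -> y < h.
  by rewrite child_cell_max /in_interior /=; lra.
case: (unliftP ord_max i) => [j ->|->]; case: (unliftP ord_max i') => [j' ->|->].
- rewrite (inj_eq lift_inj) => jj; apply/negP => /andP[/sub[ij _] /sub[ij' _]].
  by have := cell_disjoint R x y jj; rewrite ij ij'.
- by move=> _; apply/negP => /andP[/sub[_ ?] /low]; lra.
- by move=> _; apply/negP => /andP[/low ? /sub[_]]; lra.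
- by rewrite eqxx.
Qed.

Lemma child_cell_no_four x y : (#|[set i | in_rect (child_cell i) x y]| <= 3)%N.
Proof.
have hY := h_range.
case: (lerP y h) => hy; last first.
  apply: leq_trans (no_four_meet R x y).
  apply: leq_trans (leq_imset_card (lift ord_max) _).
  apply: subset_leq_card; apply/subsetP => i; rewrite inE => ixy.
  case: (unliftP ord_max i) ixy => [j ->|->]; last first.
    by rewrite child_cell_max /in_rect /=; lra.
  move=> jxy; apply: imset_f; move: jxy; rewrite inE child_cell_lift /in_rect.
  by have [-> -> -> [[_ -> ?]|[_ -> ?]]] := raised_cellP j; lra.
(* Up to height [h] only the strip and the raised cells occur. Of the latter at most one has [x] in
   its half-open horizontal range and at most one ends at [x], which makes three cells in all. *)
pose A := [set j | touches_bottom R j && (x0 j <= x < x1 j)].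
pose B := [set j | touches_bottom R j && (x == x1 j)].
have A1 : (#|A| <= 1)%N.
  apply/card_le1_eqP => j j'; rewrite !inE => /andP[/eqP jb ?] /andP[/eqP jb' ?].
  have [_ ?] := cell_lt R j; have [_ ?] := cell_lt R j'.
  by apply: (@overlap_eq _ _ R); lra.
have B1 : (#|B| <= 1)%N.
  apply/card_le1_eqP => j j'; rewrite !inE => /andP[/eqP jb ?] /andP[/eqP jb' ?].
  have [? ?] := cell_lt R j; have [? ?] := cell_lt R j'.
  by apply: (@overlap_eq _ _ R); lra.
have sub : [set i | in_rect (child_cell i) x y] \subset
    [set ord_max] :|: (lift ord_max @: A :|: lift ord_max @: B).
  apply/subsetP => i; rewrite inE => ixy; rewrite !inE.
  case: (unliftP ord_max i) ixy => [j ->|->]; last by rewrite eqxx.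
  rewrite child_cell_lift /in_rect.
  have [-> -> -> [[jb -> _]|[_ -> ?]]] := raised_cellP j; last by lra.
  move=> jxy; apply/orP; right; apply/orP.
  case: (ltrP x (x1 j)) => ?; [left|right]; apply: imset_f; rewrite inE jb /=; first lra.
  by rewrite eq_le; lra.
apply: leq_trans (subset_leq_card sub) _.
apply: leq_trans (leq_card_setU _ _) _; rewrite cards1 add1n ltnS.
apply: leq_trans (leq_card_setU _ _) _; rewrite -[2%N]/(1 + 1)%N.
by apply: leq_add; apply: leq_trans (leq_imset_card _ _) _.
Qed.

Definition low_child : rectangulation K n.+1 :=
  Rectangulation (box_nondegenerate R) child_cell_nondegenerate child_cell_cover
    child_cell_disjoint child_cell_no_four.

(** The top-left vertex of the strip is on the left side of the box: it has arms to the right,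
    upwards and downwards, and none to the left. Its type prescribes the slide of the top side,
    which lowers the raised cells again. *)
Lemma deletes_low_child : deletes low_child R.
Proof.
have [bx by_] := box_lt R; have hY := h_range.
have [||k [kx ky]] := @cell_NE _ _ R X0 Y0; try lra.
have [? ? ? ?] := cell_in_box R k; have [hk hk'] := h_low k.
have [k1 k2 k3 k4] := raised_cellP k.
exists ord_max; split=> //=.
- by rewrite /touches_bottom /= child_cell_max.
- by rewrite /touches_right /= child_cell_max.
rewrite child_cell_max /=; left; split; last first.
  move=> j; rewrite child_cell_lift; have [j1 j2 j3 j4] := raised_cellP j.
  have [? ?] := cell_lt R j; have [? ? ? ?] := cell_in_box R j.
  case: ifPn => /belowP /=; rewrite child_cell_max child_cell_lift /= j1 j2 ?j3.
    move=> [hb _ _]; case: j4 => [[_ _ jY]|[_ ? ?]]; last by exfalso; lra.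
    by rewrite -jY; case: (cell R j).
  case: j4 => [[_ jh _]|[jb _ _] _]; last by rewrite /raised_cell (negPf jb).
  by case; split; lra.
split; first by apply/existsP; exists ord_max; rewrite /= child_cell_max /is_corner !eqxx orbT.
have new_boundary x y : on_boundary (Rect X0 X1 Y0 h) x y ->
    [exists i, on_boundary (cell low_child i) x y].
  by move=> b; apply/existsP; exists ord_max; rewrite /= child_cell_max.
have new_vertex x y : is_corner (Rect X0 X1 Y0 h) x y -> vertex low_child x y.
  by move=> b; apply/existsP; exists ord_max; rewrite /= child_cell_max.
case; split=> // hd.
- exists (Segment Horizontal h X0 X1) => //; split=> //= x y.
    by rewrite /endpoint /= => exy; apply: new_vertex; rewrite /is_corner /= !eq_le; lra.
  by rewrite /on_segment /= => sxy; apply: new_boundary;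
    rewrite /on_boundary /in_rect /in_interior /=; lra.
- case: hd => -[d a l r] /line_segmentP[/= lr _ inb _] [/= dd aa rr]; subst d a r.
  by exfalso; have := inb l h; rewrite /on_segment /in_rect /= eqxx lexx /=; lra.
- exists (Segment Vertical X0 Y0 h) => //; split=> //=; first lra.
    by move=> x y; rewrite /endpoint /= => exy; apply: new_vertex; rewrite /is_corner /= !eq_le; lra.
  by move=> x y; rewrite /on_segment /= => sxy; apply: new_boundary;
    rewrite /on_boundary /in_rect /in_interior /=; lra.
(* The upward arm is the left side of the raised bottom-left cell. *)
- have kh : yb (raised_cell k) = h by case: k4 => [[]//|[]]; lra.
  exists (Segment Vertical X0 h (y1 k)) => //; split=> //= x y sxy;
    apply/existsP; exists (lift ord_max k); rewrite /= child_cell_lift.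
    by move: sxy; rewrite /endpoint /is_corner /= k1 k3 kh !eq_le; lra.
  move: sxy; rewrite /on_segment /on_boundary /in_rect /in_interior /=.
  by rewrite k1 k2 k3 kh; lra.
Qed.

Lemma first_child_low_child : first_child R low_child.
Proof.
have [bx by_] := box_lt R; have hY := h_range.
have [||k [kx ky]] := @cell_NE _ _ R X0 Y0; try lra.
have [? ? ? ?] := cell_in_box R k; have [hk _] := h_low k.
have [? ?] := cell_lt R k.
have [kX kY] : x0 k = X0 /\ y0 k = Y0 by split; lra.
(* On the edge in the bottom-left corner the point at height [h] is chosen, so that inserting there
   produces exactly [low_child]. *)
pose e0 := Segment Vertical X0 Y0 (y1 k); pose q0 := (X0, h).
have e0_edge : edge R e0 by apply: bottom_left_edge.
have q0_e0 : inside_segment e0 q0.1 q0.2 by rewrite /inside_segment /= eqxx; lra.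
have e0_ins : vertical_insertion_edge R e0.
  by split=> //; exists k; rewrite /touches_bottom ?kX ?kY.
(* All other vertical insertion edges are to the right of the left side of the box. Their points,
   chosen arbitrarily, come after [q0] in the lexicographic order. *)
pose E e := vertical_insertion_edge R e /\ e <> e0.
have Eleft e : E e -> X0 < seg_at e.
  move=> [[ee [i ib [dv ai li hi]]] ne]; have [? ? ? ?] := cell_in_box R i.
  have [? ?] := cell_lt R i; rewrite lt_neqAle; apply/andP; split; last lra.
  apply/eqP => aX; apply: ne; have ki : i = k.
    by move/eqP: ib => ib; apply: (@overlap_eq _ _ R); lra.
  apply: (proj2 e0_edge); first by case: ee.
  rewrite ki in li hi; case: (e) dv aX li hi => d a l r /= -> <- li hi x y.
  by rewrite /on_segment /=; lra.
have [vs uvs [vs1 vs2]] : exists2 qs, uniq qs & one_point_on_each E qs.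
  apply: (@exists_one_point_on_each _ _ R Vertical).
  by move=> e [[ee [i _ [-> _ _ _]]] _].
have [vs' pvs svs] := strict_sort (@lex_xy_trans K) (@lex_xy_total K) uvs.
have [hs uhs hsP] : exists2 qs, uniq qs & one_point_on_each (horizontal_insertion_edge R) qs.
  apply: (@exists_one_point_on_each _ _ R Horizontal).
  by move=> e [ee [i _ [-> _ _ _]]].
have [hs' phs shs] := strict_sort (@lex_yx_trans K) (@lex_yx_total K) uhs.
have dirE e : vertical_insertion_edge R e -> seg_dir e = Vertical.
  by case=> _ [i _ []].
have [vs'1 vs'2] := one_point_on_each_perm pvs (conj vs1 vs2).
exists R, (q0 :: vs'), hs', low_child; split.
- by exists 1%g => i j; rewrite !perm1.
- split=> //; last exact: one_point_on_each_perm phs hsP.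
  + split=> [q|e ee].
      rewrite inE => /orP[/eqP->|/vs'1[e [? _] ?]]; first by exists e0.
      by exists e.
    rewrite /=; case: (classic (e = e0)) => [->|ne].
      rewrite q0_e0 (@eq_in_count _ _ pred0) ?count_pred0 // => q /vs'1[e' [e'v e'n] i'].
      apply/negP => i; apply: e'n; apply: (@edge_unique _ _ R) i' i => //; first by case: e'v.
      exact: dirE.
    rewrite vs'2 // (_ : inside_segment _ _ _ = false) //; apply/negP => i.
    apply: ne; apply: (@edge_unique _ _ R) i q0_e0 => //; first by case: ee.
    exact: dirE.
  + rewrite /= path_min_sorted //; apply/allP => q /vs'1[e Ee].
    have := Eleft _ Ee; rewrite /inside_segment dirE; last by case: Ee.
    by rewrite /lex_xy /=; lra.
- by [].
- split=> //=; first exact: child_cell_max.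
  move=> j; rewrite child_cell_lift /raised_cell.
  by have [-> _ _ _] := cell_in_box R j; rewrite andbT.
- by exists 1%g => i j; rewrite !perm1.
Qed.

End FirstChild.

Lemma exists_first_child (K : realFieldType) n (R : rectangulation K n) :
  exists2 S, first_child R S & parent S R.
Proof.
have [bx by_] := box_lt R.
(* No coordinate of a cell lies in the interval from the bottom of the box, exclusive, to [h]. *)
have [h [h1 h2 h3]] := @rightward_gap _ (coordinates R) _ _ by_.
have low i : h < yt (cell R i) /\ (yb (cell R i) = yb (box R) \/ h < yb (cell R i)).
  have [? ? ? ?] := cell_in_box R i; have [_ ?] := cell_lt R i.
  have [_ _ ci1 ci2] := mem_coordinates R i; split.
    by rewrite ltNge; apply/negP => /(h3 _ ci2); lra.
  by case: (ltrP h (yb (cell R i))) => [|/(h3 _ ci1) ?]; [right|left; lra].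
have hr : yb (box R) < h < yt (box R).
  have [||k [kx ky]] := @cell_NE _ _ R (xl (box R)) (yb (box R)); try lra.
  have [? ? ? ?] := cell_in_box R k; have [? _] := low k; lra.
exists (low_child hr low); first exact: first_child_low_child.
by exists R; [apply: deletes_low_child|exists 1%g => i j; rewrite !perm1].
Qed.

(** * Zigzag sets and avoidance *)

Section Zigzag.

Variable K : realFieldType.

(** Predicates are not identified extensionally, while the induction yields [avoiding (parents C)]
    and the constructor asks for [parents (avoiding C)]. *)
Lemma zigzag_ext n (C C' : rectangulation K n -> Prop) :
  zigzag C -> (forall R, C R <-> C' R) -> zigzag C'.
Proof.
move=> zC; elim: zC C' => {n C} [C hC|n C sC zP IH h1 h2] C' CC'.
  by apply: zigzag_square => R; rewrite -CC'.
have PP R : parents C R <-> parents C' R.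
  by split=> -[T /CC' ? ?]; exists T.
apply: zigzag_parents.
- by move=> R S e /CC' CR; apply/CC'; apply: sC e CR.
- exact: IH.
- by move=> R /PP PR S fS; apply/CC'; apply: h1 fS.
- by move=> R /PP PR S fS; apply/CC'; apply: h2 fS.
Qed.

Lemma equivalent_sym n (R S : rectangulation K n) : equivalent R S -> equivalent S R.
Proof.
move=> [f h]; exists f^-1%g => i j; have [h1 h2] := h (f^-1%g i) (f^-1%g j).
by rewrite -h1 -h2 !permKV.
Qed.

Lemma contains_parent n (R : rectangulation K n.+1) S P :
  parent R S -> contains S P -> contains R P.
Proof.
move=> [S0 d /equivalent_sym e] c; apply: contains_before_deletion d _.
exact: contains_equivalent e c.
Qed.

(* A wall has cells on both of its sides. *)
Lemma single_cell_avoids (R : rectangulation K 1) P : avoids R P.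
Proof.
have novwall (S : rectangulation K 1) c lo hi : ~ vwall S c lo hi.
  move=> W; have [|i [[ic _ _] _ _]] := @cell_above _ _ _ _ _ _ W true lo.
    by have [[_ ? _ _] _ _ _] := W; lra.
  have [|j [[jc _ _] _ _]] := @cell_above _ _ _ _ _ _ W false lo.
    by have [[_ ? _ _] _ _ _] := W; lra.
  by apply: (@side_neq _ _ S true i j); [rewrite ic jc|rewrite (ord1 i) (ord1 j)].
case=> f [_ /(_ (Ordinal (pat_walls_gt0 P)))[/wallP + _] _ _].
by case: (f _) => -[] c lo hi; [move=> /vwall_reflect|]; apply: novwall.
Qed.

Lemma saturated_avoiding n (C : rectangulation K n -> Prop) PP :
  saturated C -> saturated (avoiding C PP).
Proof.
move=> sC R S e [CR aR]; split; first exact: sC e CR.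
by move=> P /aR; apply: contra_not; apply: contains_equivalent (equivalent_sym e).
Qed.

Lemma zigzag_avoiding n (C : rectangulation K n -> Prop) PP :
  (forall P, PP P -> tame K P) -> zigzag C -> zigzag (avoiding C PP).
Proof.
move=> tPP; elim=> {n C} [C hC|n C sC zP IH h1 h2].
  apply: zigzag_square => R; rewrite -hC; split=> [[]//|CR].
  by split=> // P _; apply: single_cell_avoids.
have parentsE S : parents (avoiding C PP) S <-> avoiding (parents C) PP S.
  split=> [[R [CR aR] RS]|[PS aS]].
    split; first by exists R.
    by move=> P /aR; apply: contra_not; apply: contains_parent RS.
  (* A preimage of [S] inside the avoiding set: the zigzag property of C puts [T] in C, and tameness
     makes it avoid the patterns. *)
  have [T fT pT] := exists_first_child S.
  exists T => //; split; first exact: h1 fT.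
  by move=> P PPP; have [tP _] := tPP P PPP _ _ (aS P PPP); apply: tP.
apply: zigzag_parents.
- exact: saturated_avoiding.
- by apply: (zigzag_ext IH) => S; rewrite parentsE.
- move=> R /parentsE[PR aR] S fS; split; first exact: h1 fS.
  by move=> P PPP; have [tP _] := tPP P PPP _ _ (aR P PPP); apply: tP.
- move=> R /parentsE[PR aR] S fS; split; first exact: h2 fS.
  by move=> P PPP; have [_ tP] := tPP P PPP _ _ (aR P PPP); apply: tP.
Qed.

(** A pattern found in the reflection of R occurs reflected in R, and the symmetry of [PP] provides
    an isomorphic copy of that reflected pattern in [PP]. *)
Lemma symmetric_avoiding n (C : rectangulation K n -> Prop) PP :
  symmetric_rectangulations C -> symmetric_patterns PP ->
  symmetric_rectangulations (avoiding C PP).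
Proof.
move=> sC sPP R [CR aR]; split=> [|P PPP /contains_reflect c]; first exact: sC.
by have [Q PPQ QP] := sPP P PPP; apply: (aR Q PPQ); apply: contains_pattern_iso QP c.
Qed.

End Zigzag.

Theorem theorem7 (K : realFieldType) (n : nat)
    (C : rectangulation K n -> Prop) (PP : pattern -> Prop) :
  (0 < n)%N -> saturated C -> zigzag C ->
  (forall P : pattern, PP P -> tame K P) ->
  (saturated (avoiding C PP) /\ zigzag (avoiding C PP)) /\
  (symmetric_rectangulations C -> symmetric_patterns PP ->
   symmetric_rectangulations (avoiding C PP)).
Proof.
move=> _ sC zC tPP; split; last exact: symmetric_avoiding.
by split; [apply: saturated_avoiding|apply: zigzag_avoiding].
Qed.
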